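(* Let $\mathcal R$ be a class of commutative rings such that $R[s^{-1}]\in\mathcal R$ for all $R\in\mathcal R$ and $s\in R$. Let $(\mathsf E_R\subset\mathsf K_R)_{R\in\mathcal R}$ be a system of classes of modules or complexes such that, for every $R\in\mathcal R$, the class $\mathsf E_R$ is closed under extensions and direct summands in $\mathsf K_R$. Assume further that the system of classes $\mathsf E$ is very local. Let $(\mathsf A_R\subset\mathsf E_R)_{R\in\mathcal R}$ and $(\mathsf B_R\subset\mathsf E_R)_{R\in\mathcal R}$ be two systems of classes such that, for every $R\in\mathcal R$, the pair of classes $(\mathsf A_R,\mathsf B_R)$ is a hereditary complete cotorsion pair in the exact category $\mathsf E_R$ (with the exact structure inherited from the abelian exact structure of $\mathsf K_R$). Then the following implications hold: (a) if the class $\mathsf B$ is antilocal, then the class $\mathsf A$ is local; (b) if the class $\mathsf A$ is very local, then the class $\mathsf B$ is antilocal; (c) if the class $\mathsf A$ is very local, then the system of classes $\mathsf A\cap\mathsf B=(\mathsf A_R\cap\mathsf B_R)_{R\in\mathcal R}$ is strongly antilocal.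
   Context: For a commutative ring $R$, $\mathsf K_R$ denotes either the abelian category $R\text{-Mod}$ of $R$-modules (for all $R$ simultaneously) or the abelian category $\mathbf C(R\text{-Mod})$ of unbounded cochain complexes of $R$-modules (for all $R$ simultaneously). For $s\in R$, $R[s^{-1}]$ is the localization of $R$ inverting $s$, and $M[s^{-1}]=R[s^{-1}]\otimes_RM$ (applied termwise to complexes). Objects of $\mathsf K_{R[s^{-1}]}$ are viewed as objects of $\mathsf K_R$ by restriction of scalars. Classes of objects (= full subcategories) are closed under isomorphisms. A system of classes $\mathsf L=(\mathsf L_R\subset\mathsf K_R)_{R\in\mathcal R}$ is also called ''a class $\mathsf L$''. Conditions on $\mathsf L$: - Ascent: for any $R\in\mathcal R$, $s\in R$, $M\in\mathsf L_R$, one has $M[s^{-1}]\in\mathsf L_{R[s^{-1}]}$. - Descent: if $R\in\mathcal R$, $s_1,\dots,s_d\in R$ generate the unit ideal, and $M\in\mathsf K_R$ satisfies $M[s_j^{-1}]\in\mathsf L_{R[s_j^{-1}]}$ for all $1\le j\le d$, then $M\in\mathsf L_R$. - Direct image condition: for any $R\in\mathcal R$ and $s\in R$, every object of $\mathsf L_{R[s^{-1}]}$, viewed in $\mathsf K_R$, belongs to $\mathsf L_R$. $\mathsf L$ is local if it satisfies ascent and descent; very local if it is local and satisfies the direct image condition. $\mathsf L$ is antilocal if, for any $R\in\mathcal R$ and any finite collection $s_1,\dots,s_d\in R$ generating the unit ideal, an object $M\in\mathsf K_R$ belongs to $\mathsf L_R$ if and only if $M$ is a direct summand of an object $F\in\mathsf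 K_R$ having a finite filtration by submodules/subcomplexes $0=F_0\subset F_1\subset\dots\subset F_N=F$ such that for every $1\le i\le N$ there is $1\le j\le d$ for which $F_i/F_{i-1}$ is obtained by restriction of scalars from an object of $\mathsf L_{R[s_j^{-1}]}$. $\mathsf L$ is strongly antilocal if, for any $R\in\mathcal R$ and any finite collection $s_1,\dots,s_d\in R$ generating the unit ideal, an object $M\in\mathsf K_R$ belongs to $\mathsf L_R$ if and only if $M$ is a direct summand of an object $\bigoplus_{j=1}^dD_j$ of $\mathsf K_R$, where each $D_j$ is obtained by restriction of scalars from an object of $\mathsf L_{R[s_j^{-1}]}$. Cotorsion pairs: a full subcategory closed under extensions in an abelian category is an exact category (Quillen) whose admissible short exact sequences are the short exact sequences with all terms in the subcategory. In an exact category $\mathsf E$, a pair of classes $(\mathsf A,\mathsf B)$ is a cotorsion pair if $\mathsf B=\{X\in\mathsf E:\operatorname{Ext}^1_{\mathsf E}(A,X)=0\ \forall A\in\mathsf A\}$ and $\mathsf A=\{Y\in\mathsf E:\operatorname{Ext}^1_{\mathsf E}(Y,B)=0\ \forall B\in\mathsf B\}$. It is complete if for every $E\in\mathsf E$ there are admissible short exact sequences $0\to B'\to A\to E\to0$ and $0\to E\to B\to A'\to0$ with $A,A'\in\mathsf A$ and $B,B'\in\mathsf B$. A complete cotorsion pair is hereditary if $\mathsf A$ is closed under kernels of admissible epimorphisms in $\mathsf E$ (equivalently, $\mathsf B$ is closed under cokernels of admissible monomorphisms; equivalently, $\operatorname{Ext}^n_{\mathsf E}(A,B)=0$ for all $A\in\mathsf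 A$, $B\in\mathsf B$, $n\ge1$). *)

(* Defs.v *)
From HB Require Import structures.
From mathcomp Require Import all_boot all_order all_algebra.
From mathcomp Require Import boolp zify.

Set Implicit Arguments.
Unset Strict Implicit.
Unset Printing Implicit Defensive.

Import GRing.Theory.
Local Open Scope ring_scope.
Local Open Scope quotient_scope.

(* Rings are comPzRingType: the zero ring is allowed, since R[s^-1] = 0 when s
   is nilpotent. *)

Section LocalizationCarrier.
Variables (R : comPzRingType) (s : R) (M : lmodType R).

(* The pair (m, n) represents the fraction m / s^n. *)
Definition frac_rel (x y : M * nat) : bool :=
  `[< exists k, s ^+ (k + y.2) *: x.1 = s ^+ (k + x.2) *: y.1 >].

Lemma frac_rel_refl : reflexive frac_rel.
Proof. by move=> x; apply/asboolP; exists 0%N. Qed.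

Lemma frac_rel_sym : symmetric frac_rel.
Proof.
by move=> x y; apply/asboolP/asboolP => -[k e]; exists k.
Qed.

Lemma frac_rel_trans : transitive frac_rel.
Proof.
move=> [y b] [x a] [z c] /asboolP[/= k e] /asboolP[/= l e'].
apply/asboolP; exists (k + l + b)%N => /=.
have -> : (k + l + b + c = (l + c) + (k + b))%N by lia.
rewrite exprD -scalerA e scalerA mulrC -scalerA.
rewrite (_ : s ^+ (l + c) *: y = s ^+ (l + b) *: z) // scalerA -exprD.
by congr (_ ^+ _ *: _); lia.
Qed.

Canonical frac_equiv :=
  EquivRel frac_rel frac_rel_refl frac_rel_sym frac_rel_trans.

Definition localization : Type := {eq_quot frac_rel}.

HB.instance Definition _ := Choice.copy localization {eq_quot frac_rel}.

Definition frac (m : M) (n : nat) : localization := \pi_({eq_quot frac_rel}) (m, n).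

Lemma fracP (x : localization) : exists m n, x = frac m n.
Proof.
exists (repr (x : {eq_quot frac_rel})).1, (repr (x : {eq_quot frac_rel})).2.
by rewrite /frac -surjective_pairing reprK.
Qed.

Lemma frac_eq m n m' n' :
  frac m n = frac m' n' <->
  exists k, s ^+ (k + n') *: m = s ^+ (k + n) *: m'.
Proof.
by split=> [/eqmodP/asboolP|e]; last by apply/eqmodP/asboolP.
Qed.

Lemma frac_expand m n k : frac (s ^+ k *: m) (k + n) = frac m n.
Proof.
apply/frac_eq; exists 0%N; rewrite scalerA -exprD.
by congr (_ ^+ _ *: _); lia.
Qed.

Lemma frac_common (x y : localization) :
  exists m m' n, x = frac m n /\ y = frac m' n.
Proof.
have [m [n ->]] := fracP x; have [m' [n' ->]] := fracP y.
exists (s ^+ n' *: m), (s ^+ n *: m'), (n + n')%N.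
by rewrite frac_expand (addnC n) frac_expand.
Qed.

End LocalizationCarrier.

Section LocalizationZmod.
Variables (R : comPzRingType) (s : R) (M : lmodType R).

Local Notation L := (localization s M).
Local Notation rp x := (repr (x : {eq_quot (@frac_rel R s M)})).
Local Notation frac := (@frac R s M).

Definition loc_zero : L := frac 0 0.
Definition loc_opp (x : L) : L := frac (- (rp x).1) (rp x).2.
Definition loc_add (x y : L) : L :=
  frac (s ^+ (rp y).2 *: (rp x).1 + s ^+ (rp x).2 *: (rp y).1)
       ((rp x).2 + (rp y).2).

Lemma repr_fracP m n : exists k,
  s ^+ (k + n) *: (rp (frac m n)).1 = s ^+ (k + (rp (frac m n)).2) *: m.
Proof.
apply/frac_eq; rewrite {1}/Defs.frac -surjective_pairing.
exact: reprK.
Qed.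

Lemma loc_oppE m n : loc_opp (frac m n) = frac (- m) n.
Proof.
rewrite /loc_opp; have [k e] := repr_fracP m n.
by apply/frac_eq; exists k; rewrite !scalerN e.
Qed.

Lemma loc_addE m n m' n' :
  loc_add (frac m n) (frac m' n') = frac (s ^+ n' *: m + s ^+ n *: m') (n + n').
Proof.
rewrite /loc_add; have [k] := repr_fracP m n; have [l] := repr_fracP m' n'.
case: (rp (frac m n)) => a p; case: (rp (frac m' n')) => b q /= eb ea.
apply/frac_eq; exists (k + l)%N; rewrite !scalerDr !scalerA -!exprD.
congr (_ + _).
  rewrite (_ : (k + l + (n + n') + q = (l + n' + q) + (k + n))%N); last by lia.
  by rewrite exprD -scalerA ea scalerA -exprD; congr (_ ^+ _ *: _); lia.
rewrite (_ : (k + l + (n + n') + p = (k + n + p) + (l + n'))%N); last by lia.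
by rewrite exprD -scalerA eb scalerA -exprD; congr (_ ^+ _ *: _); lia.
Qed.

Lemma frac_addl m m' n : loc_add (frac m n) (frac m' n) = frac (m + m') n.
Proof. by rewrite loc_addE -scalerDr frac_expand. Qed.

Lemma loc_addC : commutative loc_add.
Proof.
move=> x y; have [m [m' [n [-> ->]]]] := frac_common x y.
by rewrite !frac_addl addrC.
Qed.

Lemma loc_addA : associative loc_add.
Proof.
move=> x y z; have [m [n ->]] := fracP x; have [m' [n' ->]] := fracP y.
have [m'' [n'' ->]] := fracP z.
rewrite !loc_addE addnA; congr (frac _ _).
by rewrite !scalerDr !scalerA -!exprD addrA (addnC n') (addnC n n'').
Qed.

Lemma loc_add0 : left_id loc_zero loc_add.
Proof.
move=> x; have [m [n ->]] := fracP x.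
by rewrite loc_addE scaler0 add0r expr0 scale1r.
Qed.

Lemma loc_addN : left_inverse loc_zero loc_opp loc_add.
Proof.
move=> x; have [m [n ->]] := fracP x.
rewrite loc_oppE frac_addl addNr; apply/frac_eq; exists 0%N.
by rewrite !scaler0.
Qed.

HB.instance Definition _ := GRing.isZmodule.Build L
  loc_addA loc_addC loc_add0 loc_addN.

Lemma fracD m m' n : frac (m + m') n = frac m n + frac m' n.
Proof. by rewrite -frac_addl. Qed.

Lemma frac0 n : frac 0 n = 0.
Proof. by apply/frac_eq; exists 0%N; rewrite !scaler0. Qed.

End LocalizationZmod.

Definition loc_ring (R : comPzRingType) (s : R) : Type := localization s R^o.

HB.instance Definition _ (R : comPzRingType) (s : R) :=
  GRing.Zmodule.copy (loc_ring s) (localization s R^o).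

Section LocalizationScale.
Variables (R : comPzRingType) (s : R).

Definition rfrac (r : R) (n : nat) : loc_ring s := frac s (r : R^o) n.

Lemma rfracP (a : loc_ring s) : exists r n, a = rfrac r n.
Proof. exact: (@fracP R s R^o a). Qed.

Lemma rfrac_common (a b : loc_ring s) :
  exists r r' n, a = rfrac r n /\ b = rfrac r' n.
Proof. exact: (@frac_common R s R^o a b). Qed.

Lemma rfracD r r' n : rfrac (r + r') n = rfrac r n + rfrac r' n.
Proof. exact: (@fracD R s R^o). Qed.

Variable M : lmodType R.

Local Notation rp M x := (repr (x : {eq_quot (@frac_rel R s M)})).

(* (r / s^n) *: (m / s^n') = (r *: m) / s^(n + n') *)
Definition loc_scale (a : loc_ring s) (x : localization s M) :
    localization s M :=
  frac s ((rp R^o a).1 *: (rp M x).1) ((rp R^o a).2 + (rp M x).2).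

Lemma loc_scaleE r n m n' :
  loc_scale (rfrac r n) (frac s m n') = frac s (r *: m) (n + n').
Proof.
rewrite /loc_scale /rfrac.
have [k] := repr_fracP s (r : R^o) n; have [l] := repr_fracP s m n'.
case: (rp R^o _) => a p; case: (rp M _) => b q /= eb.
rewrite -[_ *: _]/(s ^+ _ * _) -[X in _ = X]/(s ^+ _ * _) => ea.
have scal_split i j (u : R) (v : M) :
    s ^+ (i + j) *: (u *: v) = (s ^+ i * u) *: (s ^+ j *: v).
  by rewrite exprD !scalerA; congr (_ *: _); rewrite -!mulrA (mulrC u).
apply/frac_eq; exists (k + l)%N.
rewrite (_ : (k + l + (n + n') = (k + n) + (l + n'))%N); last by lia.
rewrite (_ : (k + l + (p + q) = (k + p) + (l + q))%N); last by lia.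
by rewrite !scal_split eb [in LHS]ea.
Qed.

End LocalizationScale.

Section LocalizationRing.
Variables (R : comPzRingType) (s : R).

Definition loc_mul (a b : loc_ring s) : loc_ring s := loc_scale a b.

Lemma loc_mulE (r r' : R) n n' :
  loc_mul (rfrac s r n) (rfrac s r' n') = rfrac s (r * r') (n + n').
Proof. exact: loc_scaleE. Qed.

Lemma loc_mulA : associative loc_mul.
Proof.
move=> x y z; have [m [n ->]] := rfracP x; have [m' [n' ->]] := rfracP y.
by have [m'' [n'' ->]] := rfracP z; rewrite !loc_mulE mulrA addnA.
Qed.

Lemma loc_mulC : commutative loc_mul.
Proof.
move=> x y; have [m [n ->]] := rfracP x; have [m' [n' ->]] := rfracP y.
by rewrite !loc_mulE mulrC addnC.
Qed.

Lemma loc_mul1 : left_id (rfrac s 1 0) loc_mul.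
Proof. by move=> x; have [m [n ->]] := rfracP x; rewrite loc_mulE mul1r. Qed.

Lemma loc_mulD : left_distributive loc_mul +%R.
Proof.
move=> x y z; have [m [m' [n [-> ->]]]] := rfrac_common x y.
by have [m'' [n'' ->]] := rfracP z; rewrite -rfracD !loc_mulE mulrDl rfracD.
Qed.

HB.instance Definition _ := GRing.Zmodule_isComPzRing.Build (loc_ring s)
  loc_mulA loc_mulC loc_mul1 loc_mulD.

Lemma rfracM r r' n n' :
  rfrac s (r * r') (n + n') = rfrac s r n * rfrac s r' n'.
Proof. by rewrite -loc_mulE. Qed.

Definition to_loc (r : R) : loc_ring s := rfrac s r 0.

Lemma to_loc_zmod : zmod_morphism to_loc.
Proof.
by move=> x y; apply/(addIr (to_loc y)); rewrite -rfracD !subrK.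
Qed.

Lemma to_loc_monoid : monoid_morphism to_loc.
Proof. by split=> // x y; rewrite -rfracM. Qed.

HB.instance Definition _ :=
  GRing.isZmodMorphism.Build R (loc_ring s) to_loc to_loc_zmod.
HB.instance Definition _ :=
  GRing.isMonoidMorphism.Build R (loc_ring s) to_loc to_loc_monoid.

End LocalizationRing.

Section LocalizationModule.
Variables (R : comPzRingType) (s : R) (M : lmodType R).

Lemma loc_scaleA (a b : loc_ring s) (x : localization s M) :
  loc_scale a (loc_scale b x) = loc_scale (a * b) x.
Proof.
have [r [n ->]] := rfracP a; have [r' [n' ->]] := rfracP b.
by have [m [p ->]] := fracP x; rewrite -rfracM !loc_scaleE scalerA addnA.
Qed.

Lemma loc_scale1 : left_id 1 (@loc_scale R s M).
Proof. by move=> x; have [m [n ->]] := fracP x; rewrite loc_scaleE scale1r. Qed.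

Lemma loc_scaleDr : right_distributive (@loc_scale R s M) +%R.
Proof.
move=> a x y; have [m [m' [n [-> ->]]]] := frac_common x y.
by have [r [p ->]] := rfracP a; rewrite -fracD !loc_scaleE scalerDr fracD.
Qed.

Lemma loc_scaleDl (x : localization s M) :
  {morph (@loc_scale R s M)^~ x : a b / a + b}.
Proof.
move=> a b; have [r [r' [n [-> ->]]]] := rfrac_common a b.
by have [m [p ->]] := fracP x; rewrite -rfracD !loc_scaleE scalerDl fracD.
Qed.

HB.instance Definition _ := GRing.Zmodule_isLmodule.Build
  (loc_ring s) (localization s M)
  loc_scaleA loc_scale1 loc_scaleDr loc_scaleDl.

Lemma fracZ r n (m : M) n' :
  frac s (r *: m) (n + n') = rfrac s r n *: frac s m n'.
Proof. by rewrite -loc_scaleE. Qed.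

End LocalizationModule.

Section LocalizationMap.
Variables (R : comPzRingType) (s : R) (M N : lmodType R).

(* f[s^-1] : m / s^n |-> f m / s^n *)
Definition loc_map (f : {linear M -> N}) (x : localization s M) :
    localization s N :=
  let y := repr (x : {eq_quot (@frac_rel R s M)}) in frac s (f y.1) y.2.

Lemma loc_mapE f m n : loc_map f (frac s m n) = frac s (f m) n.
Proof.
rewrite /loc_map; have [k e] := repr_fracP s m n.
by apply/frac_eq; exists k; rewrite -!linearZ e.
Qed.

Lemma loc_map_linear f : linear (loc_map f : _ -> localization s N).
Proof.
move=> a x y; have [m [m' [n [-> ->]]]] := frac_common x y.
have [r [p ->]] := rfracP a; rewrite -fracZ -(frac_expand s m' n p) -fracD.
by rewrite !loc_mapE linearD !linearZ fracD fracZ frac_expand.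
Qed.

HB.instance Definition _ f := GRing.isLinear.Build
  (loc_ring s) (localization s M) (localization s N) *:%R (loc_map f)
  (loc_map_linear f).

End LocalizationMap.

(* Restriction of scalars along a ring homomorphism. *)
Definition restriction (R S : comPzRingType) (phi : {rmorphism R -> S})
  (N : lmodType S) : Type := N.

Section Restriction.
Variables (R S : comPzRingType) (phi : {rmorphism R -> S}).

Section Object.
Variable N : lmodType S.
Local Notation rN := (restriction phi N).

HB.instance Definition _ := GRing.Zmodule.copy rN N.

Definition restr_scale (r : R) (x : rN) : rN := phi r *: (x : N).

Lemma restr_scaleA a b x :
  restr_scale a (restr_scale b x) = restr_scale (a * b) x.
Proof. by rewrite /restr_scale scalerA rmorphM. Qed.

Lemma restr_scale1 : left_id 1 restr_scale.
Proof. by move=> x; rewrite /restr_scale rmorph1 scale1r. Qed.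

Lemma restr_scaleDr : right_distributive restr_scale +%R.
Proof. by move=> a x y; rewrite /restr_scale [LHS]scalerDr. Qed.

Lemma restr_scaleDl x : {morph restr_scale^~ x : a b / a + b}.
Proof. by move=> a b; rewrite /restr_scale rmorphD [LHS]scalerDl. Qed.

HB.instance Definition _ := GRing.Zmodule_isLmodule.Build R rN
  restr_scaleA restr_scale1 restr_scaleDr restr_scaleDl.

End Object.

Definition restr_map (N N' : lmodType S) (f : {linear N -> N'})
  (x : restriction phi N) : restriction phi N' := f x.

Lemma restr_map_linear (N N' : lmodType S) (f : {linear N -> N'}) :
  linear (restr_map f).
Proof. by move=> a x y; rewrite /restr_map [LHS]linearD [f (a *: x)]linearZ. Qed.

HB.instance Definition _ (N N' : lmodType S) (f : {linear N -> N'}) :=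
  GRing.isLinear.Build
  R (restriction phi N) (restriction phi N') *:%R (restr_map f)
  (restr_map_linear f).

End Restriction.

Lemma linear_ext (R : pzRingType) (U V : lmodType R) (f g : {linear U -> V}) :
  f =1 g -> f = g.
Proof.
move: f g => [f cf] [g cg] /= /funext efg; move: cf cg; rewrite efg => cf cg.
congr GRing.Linear.Pack.
case: cf cg => [[a0] [b0]] [[a1] [b1]].
by rewrite (Prop_irrelevance a0 a1) (Prop_irrelevance b0 b1).
Qed.

Section BaseChange.
Variables (R : comPzRingType) (s : R) (M : lmodType R).
Variable N : lmodType (loc_ring s).

Lemma rfrac_inv n : rfrac s 1 n * to_loc s (s ^+ n) = 1.
Proof.
rewrite -rfracM mul1r addn0; apply/frac_eq; exists 0%N.
by rewrite !add0n expr0 scale1r; exact: esym (mulr1 _).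
Qed.

Lemma s_cancel i j : rfrac s 1 (i + j) * to_loc s (s ^+ i) = rfrac s 1 j.
Proof.
by rewrite addnC -[X in rfrac s X (j + i)]mulr1 rfracM -mulrA rfrac_inv mulr1.
Qed.

(* The universal property of R[s^-1] (x)_R M: an R-linear map from M to an
   R[s^-1]-module extends uniquely along m |-> m / 1. *)
Lemma localization_base_change (f : {linear M -> restriction (to_loc s) N}) :
  exists! g : {linear localization s M -> N},
    forall m, g (frac s m 0) = f m.
Proof.
have fZ r m : (f (r *: m) : N) = to_loc s r *: (f m : N) by rewrite linearZ.
pose h (x : localization s M) : N :=
  let y := repr (x : {eq_quot (@frac_rel R s M)}) in rfrac s 1 y.2 *: (f y.1 : N).
have hE m n : h (frac s m n) = rfrac s 1 n *: (f m : N).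
  rewrite /h; have [k] := repr_fracP s m n; case: (repr _) => a p /= e.
  have e2 : to_loc s (s ^+ (k + n)) *: (f a : N) =
            to_loc s (s ^+ (k + p)) *: (f m : N) by rewrite -!fZ e.
  rewrite -(s_cancel (k + n) p) -(s_cancel (k + p) n) -!scalerA e2.
  by rewrite addnAC.
have h_linear : linear (h : _ -> N).
  move=> a x y; have [m [m' [n [-> ->]]]] := frac_common x y.
  have [r [p ->]] := rfracP a.
  rewrite -fracZ -[in LHS](frac_expand s m' n p) -fracD !hE.
  have -> : (f (r *: m + s ^+ p *: m') : N)
    = to_loc s r *: (f m : N) + to_loc s (s ^+ p) *: (f m' : N).
    by rewrite -!fZ linearD.
  by rewrite scalerDr !scalerA s_cancel -!rfracM mul1r mulr1 addn0.
pose lh := GRing.isLinear.Build _ _ _ _ h h_linear.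
pose g : {linear localization s M -> N} := HB.pack h lh.
exists g; split=> [m|g' g'E].
  by rewrite [g _]hE -[rfrac s 1 0]/(1 : loc_ring s) scale1r.
apply: linear_ext => x; have [m [n ->]] := fracP x.
by rewrite [g _]hE -g'E -linearZ -fracZ scale1r addn0.
Qed.

End BaseChange.

(* Categories with zero object, binary direct sums and distinguished short
   exact sequences 0 -> X -> Y -> Z -> 0; [ses f g] is understood to say that
   f is a kernel of g and g is a cokernel of f. *)
Record abcat := Abcat {
  obj :> Type;
  hom : obj -> obj -> Type;
  idm : forall X, hom X X;
  comp : forall X Y Z, hom Y Z -> hom X Y -> hom X Z;
  compA : forall X Y Z T (h : hom Z T) (g : hom Y Z) (f : hom X Y),
    comp h (comp g f) = comp (comp h g) f;
  comp1m : forall X Y (f : hom X Y), comp (idm Y) f = f;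
  compm1 : forall X Y (f : hom X Y), comp f (idm X) = f;
  zero_obj : obj;
  dsum : obj -> obj -> obj;
  dinl : forall X Y, hom X (dsum X Y);
  dsnd : forall X Y, hom (dsum X Y) Y;
  ses : forall X Y Z, hom X Y -> hom Y Z -> Prop
}.

Section ModuleCategory.
Variable R : comPzRingType.
Implicit Types X Y Z : lmodType R.

Definition mod_id X : {linear X -> X} := idfun.
Definition mod_comp X Y Z (g : {linear Y -> Z}) (f : {linear X -> Y}) :
  {linear X -> Z} := g \o f.

Definition mod_inl_fun X Y (x : X) : (X * Y)%type := (x, 0).

Lemma mod_inl_linear X Y : linear (@mod_inl_fun X Y).
Proof.
by move=> a x y; rewrite /mod_inl_fun; congr pair; rewrite /= scaler0 addr0.
Qed.

HB.instance Definition _ X Y :=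
  GRing.isLinear.Build R X (X * Y)%type *:%R (@mod_inl_fun X Y)
    (@mod_inl_linear X Y).

Definition mod_inl X Y : {linear X -> (X * Y)%type} := @mod_inl_fun X Y.
Definition mod_snd X Y : {linear (X * Y)%type -> Y} := snd.

Definition mod_ses X Y Z (f : {linear X -> Y}) (g : {linear Y -> Z}) :=
  [/\ injective f, forall z, exists y, g y = z
    & forall y, g y = 0 <-> exists x, f x = y].

Lemma mod_compA X Y Z (T : lmodType R) (h : {linear Z -> T})
    (g : {linear Y -> Z}) (f : {linear X -> Y}) :
  mod_comp h (mod_comp g f) = mod_comp (mod_comp h g) f.
Proof. exact: linear_ext. Qed.

Lemma mod_comp1 X Y (f : {linear X -> Y}) : mod_comp (mod_id Y) f = f.
Proof. exact: linear_ext. Qed.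

Lemma mod_compr1 X Y (f : {linear X -> Y}) : mod_comp f (mod_id X) = f.
Proof. exact: linear_ext. Qed.

(* 'rV[R]_0 is the zero module. *)
Definition modcat : abcat := @Abcat (lmodType R) (fun X Y => {linear X -> Y})
  mod_id mod_comp mod_compA mod_comp1 mod_compr1
  'rV[R]_0 (fun X Y => (X * Y)%type) mod_inl mod_snd mod_ses.

End ModuleCategory.

Record complex (R : comPzRingType) := Complex {
  term :> int -> lmodType R;
  diff : forall n : int, {linear term n -> term (n + 1)};
  diffK : forall (n : int) (x : term n), diff (n + 1) (diff n x) = 0
}.

Record chmap (R : comPzRingType) (X Y : complex R) := Chmap {
  chterm :> forall n : int, {linear X n -> Y n};
  chmapP : forall (n : int) (x : X n),
    chterm (n + 1) (diff X n x) = diff Y n (chterm n x)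
}.

Section ComplexCategory.
Variable R : comPzRingType.
Implicit Types X Y Z : complex R.

Lemma chmap_ext X Y (f g : chmap X Y) : (forall n, f n =1 g n) -> f = g.
Proof.
move: f g => [f Pf] [g Pg] /= efg.
have e : f = g.
  apply: functional_extensionality_dep => n; apply: linear_ext; exact: efg.
by move: Pg; rewrite -e => Pg; rewrite (Prop_irrelevance Pf Pg).
Qed.

Definition cx_id X : chmap X X :=
  @Chmap R X X (fun n => mod_id (X n)) (fun n x => erefl).

Lemma cx_comp_proof X Y Z (g : chmap Y Z) (f : chmap X Y) n (x : X n) :
  mod_comp (g (n + 1)) (f (n + 1)) (diff X n x) =
  diff Z n (mod_comp (g n) (f n) x).
Proof. exact: etrans (congr1 (g (n + 1)) (chmapP f x)) (chmapP g (f n x)). Qed.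

Definition cx_comp X Y Z (g : chmap Y Z) (f : chmap X Y) : chmap X Z :=
  @Chmap R X Z (fun n => mod_comp (g n) (f n)) (cx_comp_proof g f).

Definition cx_zero : complex R :=
  @Complex R (fun=> 'rV[R]_0) (fun n => \0) (fun n x => erefl).

Section DirectSum.
Variables X Y : complex R.

Definition cx_dsum_diff_fun (n : int) (z : (X n * Y n)%type) :
    (X (n + 1)%R * Y (n + 1)%R)%type :=
  (diff X n z.1, diff Y n z.2).

Lemma cx_dsum_diff_linear (n : int) : linear (@cx_dsum_diff_fun n).
Proof.
by move=> a x y; rewrite /cx_dsum_diff_fun; congr pair; rewrite linearP.
Qed.

HB.instance Definition _ n := GRing.isLinear.Build
  R (X n * Y n)%type (X (n + 1)%R * Y (n + 1)%R)%type *:%R (@cx_dsum_diff_fun n)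
  (@cx_dsum_diff_linear n).

Lemma cx_dsum_diffK (n : int) (z : (X n * Y n)%type) :
  cx_dsum_diff_fun (cx_dsum_diff_fun z) = 0.
Proof. by rewrite /cx_dsum_diff_fun !diffK. Qed.

Definition cx_dsum : complex R :=
  @Complex R (fun n => (X n * Y n)%type) (fun n => @cx_dsum_diff_fun n)
    cx_dsum_diffK.

Lemma cx_inl_proof n (x : X n) :
  mod_inl (X (n + 1)) (Y (n + 1)) (diff X n x)
  = cx_dsum_diff_fun (mod_inl (X n) (Y n) x).
Proof. by rewrite /cx_dsum_diff_fun /= linear0. Qed.

Definition cx_inl : chmap X cx_dsum :=
  @Chmap R X cx_dsum (fun n => mod_inl (X n) (Y n)) cx_inl_proof.

Definition cx_snd : chmap cx_dsum Y :=
  @Chmap R cx_dsum Y (fun n => mod_snd (X n) (Y n)) (fun n x => erefl).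

End DirectSum.

Definition cx_ses X Y Z (f : chmap X Y) (g : chmap Y Z) :=
  forall n, mod_ses (f n) (g n).

Lemma cx_compA X Y Z (T : complex R) (h : chmap Z T) (g : chmap Y Z)
    (f : chmap X Y) :
  cx_comp h (cx_comp g f) = cx_comp (cx_comp h g) f.
Proof. exact: chmap_ext. Qed.

Lemma cx_comp1 X Y (f : chmap X Y) : cx_comp (cx_id Y) f = f.
Proof. exact: chmap_ext. Qed.

Lemma cx_compr1 X Y (f : chmap X Y) : cx_comp f (cx_id X) = f.
Proof. exact: chmap_ext. Qed.

Definition cxcat : abcat := @Abcat (complex R) (@chmap R)
  cx_id cx_comp cx_compA cx_comp1 cx_compr1
  cx_zero cx_dsum cx_inl cx_snd cx_ses.

End ComplexCategory.

Section ComplexScalars.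
Variable R : comPzRingType.

Lemma cx_loc_diffK (s : R) (X : complex R) n (x : localization s (X n)) :
  loc_map (diff X (n + 1)) (loc_map (diff X n) x) = 0.
Proof.
by have [m [p ->]] := fracP x; rewrite !loc_mapE diffK frac0.
Qed.

Definition cx_loc (s : R) (X : complex R) : complex (loc_ring s) :=
  @Complex (loc_ring s) (fun n => localization s (X n))
    (fun n => loc_map (diff X n)) (@cx_loc_diffK s X).

Definition cx_restr (S : comPzRingType) (phi : {rmorphism R -> S})
    (X : complex S) : complex R :=
  @Complex R (fun n => restriction phi (X n))
    (fun n => restr_map (diff X n)) (fun n x => diffK (x : X n)).

End ComplexScalars.

Variant ambient := Modules | Complexes.

Definition K (k : ambient) (R : comPzRingType) : abcat :=
  match k with Modules => modcat R | Complexes => cxcat R end.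

Definition Kloc (k : ambient) (R : comPzRingType) (s : R) :
    K k R -> K k (loc_ring s) :=
  match k with
  | Modules => fun M => localization s M
  | Complexes => fun M => cx_loc s M
  end.

Definition Kres (k : ambient) (R : comPzRingType) (s : R) :
    K k (loc_ring s) -> K k R :=
  match k with
  | Modules => fun N => restriction (to_loc s) N
  | Complexes => fun N => cx_restr (to_loc s) N
  end.

Section CotorsionPairs.
Variable C : abcat.
Implicit Types (X Y Z : C) (E A B L : C -> Prop).

Definition is_iso X Y (f : hom X Y) :=
  exists g : hom Y X, comp g f = idm X /\ comp f g = idm Y.

Definition isomorphic X Y := exists f : hom X Y, is_iso f.

Definition direct_summand X Y := exists Z, isomorphic Y (dsum X Z).

Definition iso_closed L := forall X Y, isomorphic X Y -> L X -> L Y.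

(* The nullary case is included: a full subcategory closed under extensions is
   additive, so that it contains the zero object. *)
Definition extension_closed L :=
  L (zero_obj C) /\
  forall X Y Z (f : hom X Y) (g : hom Y Z), ses f g -> L X -> L Z -> L Y.

Definition summand_closed L := forall X Y, direct_summand X Y -> L Y -> L X.

(* Admissible short exact sequences of the exact category E. *)
Definition admissible E X Y Z (f : hom X Y) (g : hom Y Z) :=
  [/\ E X, E Y, E Z & ses f g].

(* Yoneda Ext^1_E(Z, X) = 0: every admissible extension of Z by X is equivalent
   to the trivial one. *)
Definition Ext1_vanishes E Z X :=
  forall Y (f : hom X Y) (g : hom Y Z), admissible E f g ->
    exists h : hom Y (dsum X Z),
      [/\ is_iso h, comp h f = dinl X Z & comp (dsnd X Z) h = g].

Definition cotorsion_pair E A B :=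
  (forall X, B X <-> E X /\ forall Y, A Y -> Ext1_vanishes E Y X) /\
  (forall Y, A Y <-> E Y /\ forall X, B X -> Ext1_vanishes E Y X).

Definition complete E A B :=
  forall X, E X ->
    (exists Y Z (f : hom Y Z) (g : hom Z X),
      [/\ admissible E f g, B Y & A Z]) /\
    (exists Y Z (f : hom X Y) (g : hom Y Z),
      [/\ admissible E f g, B Y & A Z]).

Definition hereditary E A :=
  forall X Y Z (f : hom X Y) (g : hom Y Z),
    admissible E f g -> A Y -> A Z -> A X.

Definition hereditary_complete_cotorsion_pair E A B :=
  [/\ cotorsion_pair E A B, complete E A B & hereditary E A].

(* X has a finite filtration 0 = F 0 <= ... <= F N = X whose successive
   quotients lie in L; the inclusions F i <= F i.+1 are the monomorphisms of
   the short exact sequences 0 -> F i -> F i.+1 -> Q -> 0. *)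
Definition finitely_filtered L X :=
  exists (N : nat) (F : nat -> C),
    [/\ isomorphic (F 0%N) (zero_obj C), isomorphic (F N) X
      & forall i, (i < N)%N ->
          exists (Q : C) (f : hom (F i) (F i.+1)) (g : hom (F i.+1) Q),
            ses f g /\ L Q].

End CotorsionPairs.

Definition unit_ideal (R : comPzRingType) (d : nat) (s : 'I_d -> R) :=
  exists c : 'I_d -> R, \sum_(j < d) c j * s j = 1.

Section Systems.
Variables (k : ambient) (RR : comPzRingType -> Prop).
(* Only the values of L at the rings in RR are relevant. *)
Variable L : forall R : comPzRingType, K k R -> Prop.

Definition ascent := forall (R : comPzRingType) (s : R) (M : K k R),
  RR R -> L M -> L (Kloc s M).

Definition descent :=
  forall (R : comPzRingType) (d : nat) (s : 'I_d -> R) (M : K k R),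
    RR R -> unit_ideal s -> (forall j, L (Kloc (s j) M)) -> L M.

Definition direct_image :=
  forall (R : comPzRingType) (s : R) (N : K k (loc_ring s)),
    RR R -> L N -> L (Kres N).

Definition local_system := ascent /\ descent.
Definition very_local := local_system /\ direct_image.

Definition antilocal :=
  forall (R : comPzRingType) (d : nat) (s : 'I_d -> R),
    RR R -> unit_ideal s ->
    forall M : K k R,
      L M <->
      exists F : K k R,
        direct_summand M F /\
        finitely_filtered
          (fun Q => exists (j : 'I_d) (N : K k (loc_ring (s j))),
            L N /\ isomorphic Q (Kres N)) F.

Definition strongly_antilocal :=
  forall (R : comPzRingType) (d : nat) (s : 'I_d -> R),
    RR R -> unit_ideal s ->
    forall M : K k R,
      L M <->
      exists D : forall j : 'I_d, K k (loc_ring (s j)),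
        (forall j, L (D j)) /\
        direct_summand M
          (\big[@dsum (K k R)/zero_obj (K k R)]_(j < d) Kres (D j)).

End Systems.

(* Main.v *)
From HB Require Import structures.
From mathcomp Require Import all_boot all_order all_algebra.
From mathcomp Require Import boolp.
(* Loaded last, because [hom] is also a notion of vector.v. *)
Require Import Defs.

(* For M over R and N over R[s^-1], Ext^1_R(M, N) = Ext^1_{R[s^-1]}(M[s^-1], N);
   hence ascent of A is equivalent to the direct image condition for B, and when
   every object of B is a summand of one filtered by objects of the B_{R[s_j^-1]},
   the vanishing of Ext^1(M, B) can be tested on the localizations of M.

   If A is very local, then (i) the special preenvelopes M[s_j^-1] -> D_j give an
   embedding of M into the direct sum of the D_j, whose cokernel C lies locally,
   hence globally, in E, and in A when M is in A; (ii) every object of E is a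
   quotient of an object of A by an object filtered by the B_{R[s_j^-1]}. For M in
   B, pulling back the sequence of (i) along the precover (ii) of C embeds M, with
   cokernel in A and therefore as a direct summand, into a filtered object. For M
   in both A and B the sequence of (i) itself splits. *)

Set Implicit Arguments.
Unset Strict Implicit.
Unset Printing Implicit Defensive.

Import GRing.Theory.
Local Open Scope ring_scope.
Local Open Scope quotient_scope.

(** Restriction of scalars is exact and has localization as an exact left adjoint, so the adjunction
    passes from Hom to Ext^1 without resolutions: an extension is transported along one functor,
    split there, and the splitting is transported back. Ascent and the direct image condition for
    [E] keep the transported sequences admissible. The obstacle in (b) is that for M in [B] the
    cokernel C is known to lie in [E] only, so nothing forces the embedding of M to split. Replacing
    C by a precover X in [A] cures this, at the price of enlarging the middle term by the kernel of
    X -> C. This is why that kernel has to be filtered by restricted objects, and why the precover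
    is built by pullbacks along the units of the localizations instead of being taken from
    completeness over R. The direct image condition for [A] is what lets a correction at one index
    preserve the others. *)

(** * Kernels, cokernels and factorizations of linear maps *)

Section KernelModule.
Variables (R : comPzRingType) (X Y : lmodType R) (f : {linear X -> Y}).

Definition ker_pred : {pred X} := [pred x | f x == 0].

Lemma ker_submod_closed : submod_closed ker_pred.
Proof.
split=> [|a x y]; rewrite !inE ?linear0 // => /eqP fx /eqP fy.
by rewrite linearP fx fy scaler0 addr0.
Qed.

HB.instance Definition _ :=
  GRing.isSubmodClosed.Build R X ker_pred ker_submod_closed.

Definition ker_mod : Type := {x : X | x \in ker_pred}.
HB.instance Definition _ := SubChoice.on ker_mod.
HB.instance Definition _ := [SubChoice_isSubLmodule of ker_mod by <:].

Definition ker_incl : {linear ker_mod -> X} := val.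

Lemma ker_incl_inj : injective ker_incl.
Proof. exact: val_inj. Qed.

Lemma ker_inclP x : f x = 0 <-> exists z, ker_incl z = x.
Proof.
split=> [fx|[[z zk] <-]]; last by apply/eqP.
by have xk : x \in ker_pred; [apply/eqP | exists (exist _ x xk)].
Qed.

End KernelModule.

Section CokernelModule.
Variables (R : comPzRingType) (X Y : lmodType R) (f : {linear X -> Y}).

Definition im_pred : {pred Y} := [pred y | `[< exists x, f x = y >]].

Lemma im_predP y : reflect (exists x, f x = y) (y \in im_pred).
Proof. exact: asboolP. Qed.

Lemma im_submod_closed : submod_closed im_pred.
Proof.
split=> [|a x y]; first by apply/im_predP; exists 0; rewrite linear0.
move=> /im_predP[x' <-] /im_predP[y' <-]; apply/im_predP.
by exists (a *: x' + y'); rewrite linearP.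
Qed.

HB.instance Definition _ :=
  GRing.isSubmodClosed.Build R Y im_pred im_submod_closed.

Definition coker_mod : Type := Quotient.quot im_pred.
HB.instance Definition _ := GRing.Zmodule.on coker_mod.

Local Notation pi y := (\pi_(Quotient.quot im_pred) y : coker_mod).

Lemma coker_eq y y' : pi y = pi y' <-> exists x, f x = y - y'.
Proof.
split=> [/eqP|e].
  by rewrite -Quotient.idealrBE => /im_predP.
by apply/eqP; rewrite -Quotient.idealrBE; apply/im_predP.
Qed.

Definition coker_scale (a : R) (y : coker_mod) : coker_mod :=
  pi (a *: repr (y : Quotient.quot im_pred)).

Lemma coker_scaleE a y : coker_scale a (pi y) = pi (a *: y).
Proof.
apply/coker_eq; rewrite -scalerBr.
have /coker_eq[x e] : pi (repr (pi y)) = pi y by exact: reprK.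
by exists (a *: x); rewrite linearZ /= e.
Qed.

Lemma coker_piD y y' : pi (y + y') = pi y + pi y'.
Proof. exact: Quotient.pi_add. Qed.

Lemma coker_surj (y : coker_mod) : exists z, pi z = y.
Proof. by exists (repr (y : Quotient.quot im_pred)); exact: reprK. Qed.

Lemma coker_scaleA a b y :
  coker_scale a (coker_scale b y) = coker_scale (a * b) y.
Proof. by have [z <-] := coker_surj y; rewrite !coker_scaleE scalerA. Qed.

Lemma coker_scale1 : left_id 1 coker_scale.
Proof. by move=> y; have [z <-] := coker_surj y; rewrite coker_scaleE scale1r. Qed.

Lemma coker_scaleDr : right_distributive coker_scale +%R.
Proof.
move=> a x y; have [z <-] := coker_surj x; have [t <-] := coker_surj y.
by rewrite -coker_piD !coker_scaleE scalerDr coker_piD.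
Qed.

Lemma coker_scaleDl y : {morph coker_scale^~ y : a b / a + b}.
Proof.
by move=> a b; have [z <-] := coker_surj y; rewrite !coker_scaleE scalerDl coker_piD.
Qed.

HB.instance Definition _ := GRing.Zmodule_isLmodule.Build R coker_mod
  coker_scaleA coker_scale1 coker_scaleDr coker_scaleDl.

Definition coker_proj_fun (y : Y) : coker_mod := pi y.

Lemma coker_proj_linear : linear coker_proj_fun.
Proof.
by move=> a x y; rewrite /coker_proj_fun coker_piD -coker_scaleE.
Qed.

HB.instance Definition _ :=
  GRing.isLinear.Build R Y coker_mod *:%R coker_proj_fun coker_proj_linear.

Definition coker_proj : {linear Y -> coker_mod} := coker_proj_fun.

Lemma coker_proj_surj y : exists z, coker_proj z = y.
Proof. exact: coker_surj. Qed.

Lemma coker_projP y : coker_proj y = 0 <-> exists x, f x = y.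
Proof.
rewrite -[0](linear0 coker_proj).
by split=> [/coker_eq|e]; last apply/coker_eq; rewrite ?subr0.
Qed.

End CokernelModule.

Section LinearFactorization.
Variables (R : comPzRingType) (X Y Z : lmodType R).

(** Single-valuedness of [P] forces any choice of values to be linear. Both factorization lemmas
    below are instances. *)
Lemma linear_of_graph (P : X -> Y -> Prop) :
    (forall x, exists y, P x y) -> (forall x y y', P x y -> P x y' -> y = y') ->
    (forall a x y x' y', P x y -> P x' y' -> P (a *: x + x') (a *: y + y')) ->
  exists f : {linear X -> Y}, forall x, P x (f x).
Proof.
move=> /choice[f fP] Pu Plin.
have f_linear : linear f by move=> a x y; apply: Pu (fP _) (Plin _ _ _ _ _ _ _).
pose lf := GRing.isLinear.Build _ _ _ _ f f_linear.
by exists (HB.pack f lf : {linear X -> Y}).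
Qed.

Lemma linear_lift (i : {linear Y -> Z}) (v : {linear X -> Z}) :
  injective i -> (forall x, exists y, i y = v x) ->
  exists u : {linear X -> Y}, forall x, i (u x) = v x.
Proof.
move=> i_inj v_im; apply: (linear_of_graph (P := fun x y => i y = v x)) => //.
  by move=> x y y' e e'; apply: i_inj; rewrite e.
by move=> a x y x' y' e e'; rewrite !linearP e e'.
Qed.

End LinearFactorization.

Lemma linear_desc (R : comPzRingType) (X Y Z : lmodType R)
    (p : {linear Y -> Z}) (v : {linear Y -> X}) :
  (forall z, exists y, p y = z) -> (forall y, p y = 0 -> v y = 0) ->
  exists u : {linear Z -> X}, forall y, u (p y) = v y.
Proof.
move=> p_surj v_ker.
have [||a z x z' x' [y -> ->] [y' -> ->]|u uP] :=
  @linear_of_graph R Z X (fun z x => exists2 y, z = p y & x = v y).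
- by move=> z; have [y <-] := p_surj z; exists (v y), y.
- move=> z x x' [y -> ->] [y' e ->]; apply/eqP; rewrite -subr_eq0 -linearB.
  by rewrite v_ker // linearB /= e subrr.
- by exists (a *: y + y'); rewrite linearP.
exists u => y; have [y' e ->] := uP (p y).
by apply/eqP; rewrite -subr_eq0 -linearB v_ker // linearB /= e subrr.
Qed.

(** * Modules and complexes as families of modules *)

(** The target type varies with the index: the terms of a complex with the degree, and the
    categories over [loc_ring (s j)] with [j]. *)
Lemma dependent_choice (I : Type) (T : I -> Type) (P : forall i, T i -> Prop) :
  (forall i, exists x, P i x) -> exists f : forall i, T i, forall i, P i (f i).
Proof. by move=> e; exists (fun i => projT1 (cid (e i))) => i; case: cid. Qed.

(* A module is handled as a complex with a single term and zero differential,
   so that both ambient categories are families of modules with operators. *)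
Definition deg (k : ambient) : Type :=
  match k with Modules => unit | Complexes => int end.

Definition nxt (k : ambient) : deg k -> deg k :=
  match k with Modules => id | Complexes => fun n => n + 1 end.

Definition trm (k : ambient) (R : comPzRingType) : K k R -> deg k -> lmodType R :=
  match k with Modules => fun M _ => M | Complexes => fun M n => M n end.

Definition dif (k : ambient) (R : comPzRingType) :
    forall (X : K k R) i, {linear trm X i -> trm X (nxt i)} :=
  match k with Modules => fun M _ => \0 | Complexes => fun M n => diff M n end.

Definition app (k : ambient) (R : comPzRingType) :
    forall X Y : K k R, hom X Y -> forall i, {linear trm X i -> trm Y i} :=
  match k with Modules => fun X Y f _ => f | Complexes => fun X Y f n => f n end.

Section SecondInclusion.
Variables (R : comPzRingType) (X Y : lmodType R).

Definition mod_inr_fun (y : Y) : (X * Y)%type := (0, y).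

Lemma mod_inr_linear : linear mod_inr_fun.
Proof.
by move=> a x y; rewrite /mod_inr_fun; congr pair; rewrite /= scaler0 addr0.
Qed.

HB.instance Definition _ :=
  GRing.isLinear.Build R Y (X * Y)%type *:%R mod_inr_fun mod_inr_linear.

Definition mod_inr : {linear Y -> (X * Y)%type} := mod_inr_fun.

End SecondInclusion.

Definition mono (k : ambient) (R : comPzRingType) (X Y : K k R) (f : hom X Y) :=
  forall i, injective (app f i).

Definition epi (k : ambient) (R : comPzRingType) (X Y : K k R) (f : hom X Y) :=
  forall i y, exists x, app f i x = y.

Section Families.
Variables (k : ambient) (R : comPzRingType).
Implicit Types X Y Z W : K k R.

Lemma hom_ext X Y (f g : hom X Y) : (forall i, app f i =1 app g i) -> f = g.
Proof.
by case: k X Y f g => X Y f g e; [exact: linear_ext (e tt) | exact: chmap_ext].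
Qed.

Lemma app_id X i x : app (idm X) i x = x.
Proof. by case: k X i x. Qed.

Lemma app_comp X Y Z (g : hom Y Z) (f : hom X Y) i x :
  app (comp g f) i x = app g i (app f i x).
Proof. by case: k X Y Z g f i x. Qed.

Lemma app_dif X Y (f : hom X Y) i x :
  app f (nxt i) (dif X i x) = dif Y i (app f i x).
Proof.
case: k X Y f i x => X Y f i x; last exact: chmapP.
by rewrite /= linear0.
Qed.

Lemma hom_of_family X Y (f : forall i, {linear trm X i -> trm Y i}) :
    (forall i x, f (nxt i) (dif X i x) = dif Y i (f i x)) ->
  exists h : hom X Y, forall i x, app h i x = f i x.
Proof.
case: k X Y f => X Y f fd; first by exists (f tt) => -[].
by exists (@Chmap R X Y f fd).
Qed.

Lemma hom_zero X Y : exists h : hom X Y, forall i x, app h i x = 0.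
Proof. by apply: (hom_of_family (f := fun i => \0)) => i x; rewrite /= linear0. Qed.

Lemma sesP X Y Z (f : hom X Y) (g : hom Y Z) :
  ses f g <-> forall i, mod_ses (app f i) (app g i).
Proof. by case: k X Y Z f g => X Y Z f g; split=> // /(_ tt). Qed.

Lemma monoP X Y (f : hom X Y) :
  mono f <-> forall i x, app f i x = 0 -> x = 0.
Proof.
split=> [fi i x fx | fi i]; first by apply: fi; rewrite fx linear0.
by apply: raddf_inj => x; exact: fi.
Qed.

Lemma ses_mono X Y Z (f : hom X Y) (g : hom Y Z) : ses f g -> mono f.
Proof. by move=> /sesP fg i; case: (fg i). Qed.

Lemma ses_epi X Y Z (f : hom X Y) (g : hom Y Z) : ses f g -> epi g.
Proof. by move=> /sesP fg i; case: (fg i). Qed.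

Lemma ses_ker X Y Z (f : hom X Y) (g : hom Y Z) : ses f g ->
  forall i y, app g i y = 0 -> exists x, app f i x = y.
Proof. by move=> /sesP fg i y; case: (fg i) => _ _ /(_ y)[]. Qed.

Lemma ses_zero X Y Z (f : hom X Y) (g : hom Y Z) : ses f g ->
  forall i x, app g i (app f i x) = 0.
Proof.
move=> /sesP fg i x; case: (fg i) => _ _ /(_ (app f i x))[_]; apply.
by exists x.
Qed.

Lemma ses_intro X Y Z (f : hom X Y) (g : hom Y Z) :
    mono f -> epi g -> (forall i x, app g i (app f i x) = 0) ->
    (forall i y, app g i y = 0 -> exists x, app f i x = y) ->
  ses f g.
Proof.
move=> fm ge gf fg; apply/sesP => i; split=> // y.
by split=> [/fg|[x <-]].
Qed.

Lemma hom_lift X Y Z (f : hom Y Z) (v : hom X Z) : mono f ->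
  (forall i x, exists y, app f i y = app v i x) ->
  exists u, comp f u = v.
Proof.
move=> fm vf; have [u uP] := dependent_choice (fun i => linear_lift (fm i) (vf i)).
have [|h hP] := @hom_of_family X Y u.
  by move=> i x; apply: fm; rewrite uP !app_dif uP.
by exists h; apply: hom_ext => i x; rewrite app_comp hP uP.
Qed.

Lemma hom_desc X Y Z (g : hom Y Z) (v : hom Y X) : epi g ->
  (forall i y, app g i y = 0 -> app v i y = 0) ->
  exists u, comp u g = v.
Proof.
move=> ge vg; have [u uP] := dependent_choice (fun i => linear_desc (ge i) (vg i)).
have [|h hP] := @hom_of_family Z X u.
  by move=> i z; have [y <-] := ge i z; rewrite -app_dif !uP app_dif.
by exists h; apply: hom_ext => i x; rewrite app_comp hP uP.
Qed.

Lemma hom_sub X Y (f g : hom X Y) :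
  exists h : hom X Y, forall i x, app h i x = app f i x - app g i x.
Proof.
apply: (hom_of_family (f := fun i => app f i \- app g i)) => i x /=.
by rewrite !app_dif linearB.
Qed.

Lemma hom_add X Y (f g : hom X Y) :
  exists h : hom X Y, forall i x, app h i x = app f i x + app g i x.
Proof.
apply: (hom_of_family (f := fun i => app f i \+ app g i)) => i x /=.
by rewrite !app_dif linearD.
Qed.

(** For complexes the kernel is taken termwise; its differential is the lift of that of [X] through
    the inclusions, whose injectivity gives the square-zero condition. *)
Lemma kernel_ex X Y (u : hom X Y) :
  exists Z (f : hom Z X), mono f /\
    forall i x, app u i x = 0 <-> exists z, app f i z = x.
Proof.
case: k X Y u => X Y u.
  exists (ker_mod u : lmodType R), (ker_incl u); split=> i.
    exact: ker_incl_inj.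
  exact: ker_inclP.
have [d dP] : exists d : forall n, {linear ker_mod (u n) -> ker_mod (u (n + 1))},
    forall n x, ker_incl (u (n + 1)) (d n x) = diff X n (ker_incl (u n) x).
  apply: (dependent_choice
    (T := fun n => {linear ker_mod (u n) -> ker_mod (u (n + 1))})
    (P := fun n d => forall x,
      ker_incl (u (n + 1)) (d x) = diff X n (ker_incl (u n) x))) => n.
  apply: (linear_lift (v := diff X n \o ker_incl (u n))) => [|x].
    exact: ker_incl_inj.
  apply/ker_inclP; rewrite /= chmapP.
  suff -> : u n (val x) = 0 by rewrite linear0.
  by apply/ker_inclP; exists x.
have dK n x : d (n + 1) (d n x) = 0.
  by apply: ker_incl_inj; rewrite !dP diffK linear0.
exists (@Complex R (fun n => ker_mod (u n)) d dK).
exists (@Chmap R (@Complex R (fun n => ker_mod (u n)) d dK) X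
  (fun n => ker_incl (u n)) dP); split=> i.
  exact: ker_incl_inj.
exact: ker_inclP.
Qed.

Lemma cokernel_ex X Y (u : hom X Y) :
  exists Z (g : hom Y Z), epi g /\
    forall i y, app g i y = 0 <-> exists x, app u i x = y.
Proof.
case: k X Y u => X Y u.
  exists (coker_mod u : lmodType R), (coker_proj u); split=> i.
    exact: coker_proj_surj.
  exact: coker_projP.
have [d dP] : exists d : forall n, {linear coker_mod (u n) -> coker_mod (u (n + 1))},
    forall n x, d n (coker_proj (u n) x) = coker_proj (u (n + 1)) (diff Y n x).
  apply: (dependent_choice
    (T := fun n => {linear coker_mod (u n) -> coker_mod (u (n + 1))})
    (P := fun n d => forall x,
      d (coker_proj (u n) x) = coker_proj (u (n + 1)) (diff Y n x))) => n.
  apply: (linear_desc (v := coker_proj (u (n + 1)) \o diff Y n)) => [|y].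
    exact: coker_proj_surj.
  move=> /coker_projP[x <-]; apply/coker_projP; exists (diff X n x).
  exact: chmapP.
have dK n x : d (n + 1) (d n x) = 0.
  have [y <-] := coker_proj_surj x.
  by rewrite !dP diffK linear0.
exists (@Complex R (fun n => coker_mod (u n)) d dK).
exists (@Chmap R Y (@Complex R (fun n => coker_mod (u n)) d dK)
  (fun n => coker_proj (u n)) (fun n x => esym (dP n x))); split=> i.
  exact: coker_proj_surj.
exact: coker_projP.
Qed.

(** [abcat] records only the first injection and the second projection; the other two maps of the
    biproduct are supplied here. *)
Lemma dsum_biproduct X Y :
  exists (p : hom (dsum X Y) X) (j : hom Y (dsum X Y)),
    [/\ forall i x, app p i (app (dinl X Y) i x) = x,
        forall i y, app p i (app j i y) = 0,
        forall i x, app (dsnd X Y) i (app (dinl X Y) i x) = 0,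
        forall i y, app (dsnd X Y) i (app j i y) = y
      & forall i z, z = app (dinl X Y) i (app p i z) + app j i (app (dsnd X Y) i z)].
Proof.
case: k X Y => X Y.
  exists (fst : {linear (X * Y)%type -> X}), (mod_inr X Y); split=> //= i [x y].
  by congr pair; rewrite /= ?addr0 ?add0r.
exists (@Chmap R (cx_dsum X Y) X (fun n => fst : {linear (X n * Y n)%type -> X n})
  (fun n x => erefl)).
have P n (y : Y n) : mod_inr (X (n + 1)) (Y (n + 1)) (diff Y n y) =
    cx_dsum_diff_fun (mod_inr (X n) (Y n) y).
  by rewrite /cx_dsum_diff_fun /= linear0.
exists (@Chmap R Y (cx_dsum X Y) (fun n => mod_inr (X n) (Y n)) P).
by split=> //= i [x y]; congr pair; rewrite /= ?addr0 ?add0r.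
Qed.

Lemma trm_zero i (x : trm (zero_obj (K k R)) i) : x = 0.
Proof. by case: k i x => i x /=; apply/rowP => -[]. Qed.

End Families.

(** * Short exact sequences *)

Section Diagrams.
Variables (k : ambient) (R : comPzRingType).
Implicit Types X Y Z W P Q : K k R.

Lemma app_eq X Y Z (f : hom X Y) (g : hom Y Z) (h : hom X Z) :
  comp g f = h -> forall i x, app g i (app f i x) = app h i x.
Proof. by move=> <- i x; rewrite app_comp. Qed.

Lemma app_eq_id X Y (f : hom X Y) (g : hom Y X) :
  comp g f = idm X -> forall i x, app g i (app f i x) = x.
Proof. by move=> e i x; rewrite (app_eq e) app_id. Qed.

Lemma isoP X Y (f : hom X Y) : is_iso f <-> mono f /\ epi f.
Proof.
split=> [[g [gf fg]]|[fm fe]].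
  split=> i; first by apply: can_inj; exact: app_eq_id gf i.
  by move=> y; exists (app g i y); exact: app_eq_id fg i y.
have [|g fg] := @hom_lift k R Y X Y f (idm Y) fm.
  by move=> i y; have [x <-] := fe i y; exists x; rewrite app_id.
exists g; split=> //; apply: hom_ext => i x; apply: fm.
by rewrite app_comp app_id (app_eq_id fg).
Qed.

Lemma iso_id X : is_iso (idm X).
Proof. by exists (idm X); rewrite comp1m. Qed.

Lemma iso_comp X Y Z (g : hom Y Z) (f : hom X Y) :
  is_iso g -> is_iso f -> is_iso (comp g f).
Proof.
move=> /isoP[gm ge] /isoP[fm fe]; apply/isoP; split=> i.
  by move=> x y; rewrite !app_comp => /gm/fm.
move=> z; have [y <-] := ge i z; have [x <-] := fe i y.
by exists x; rewrite app_comp.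
Qed.

Lemma isomorphic_refl X : isomorphic X X.
Proof. by exists (idm X); exact: iso_id. Qed.

Lemma isomorphic_sym X Y : isomorphic X Y -> isomorphic Y X.
Proof. by case=> f [g [gf fg]]; exists g, f. Qed.

Lemma isomorphic_trans X Y Z : isomorphic X Y -> isomorphic Y Z -> isomorphic X Z.
Proof. by case=> f fi [g gi]; exists (comp g f); exact: iso_comp. Qed.

Lemma ses_dsum X Y : ses (dinl X Y) (dsnd X Y).
Proof.
have [p [j [pl pj sl sj e]]] := dsum_biproduct X Y.
apply: ses_intro => [||//|].
- by move=> i; exact: can_inj (pl i).
- by move=> i y; exists (app j i y).
by move=> i z z0; exists (app p i z); rewrite [RHS]e z0 linear0 addr0.
Qed.

Lemma ses_of_epi X Y (g : hom X Y) : epi g -> exists Z (f : hom Z X), ses f g.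
Proof.
move=> ge; have [Z [f [fm fP]]] := kernel_ex g; exists Z, f.
apply: ses_intro => // [i x|i y /fP //].
by apply/fP; exists x.
Qed.

Lemma ses_of_mono X Y (f : hom X Y) : mono f -> exists Z (g : hom Y Z), ses f g.
Proof.
move=> fm; have [Z [g [ge gP]]] := cokernel_ex f; exists Z, g.
apply: ses_intro => // [i x|i y /gP //].
by apply/gP; exists x.
Qed.

Lemma ses_iso_r X Y Z W (f : hom X Y) (g : hom Y Z) (h : hom Z W) :
  ses f g -> is_iso h -> ses f (comp h g).
Proof.
move=> fg /isoP[hm he]; apply: ses_intro.
- exact: ses_mono fg.
- move=> i w; have [z <-] := he i w; have [y <-] := ses_epi fg z.
  by exists y; rewrite app_comp.
- by move=> i x; rewrite app_comp (ses_zero fg) linear0.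
move=> i y; rewrite app_comp => /(monoP h).1 gy.
exact: ses_ker fg _ _ (gy hm).
Qed.

Lemma ses_iso_l X Y Z W (f : hom X Y) (g : hom Y Z) (h : hom W X) :
  ses f g -> is_iso h -> ses (comp f h) g.
Proof.
move=> fg /isoP[hm he]; apply: ses_intro.
- by move=> i x y; rewrite !app_comp => /(ses_mono fg)/hm.
- exact: ses_epi fg.
- by move=> i x; rewrite app_comp (ses_zero fg).
move=> i y /(ses_ker fg)[x <-]; have [w <-] := he i x.
by exists w; rewrite app_comp.
Qed.

Lemma ses_of_zero X Y : isomorphic X (zero_obj _) -> exists f : hom X Y, ses f (idm Y).
Proof.
case=> h /isoP[hm _].
have X0 i (x : trm X i) : x = 0 by apply: hm; rewrite linear0; exact: trm_zero.
have [f _] := hom_zero X Y.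
exists f; apply: ses_intro => // [i x y _|i y|i x|i y].
- by rewrite (X0 _ x) (X0 _ y).
- by exists y; rewrite app_id.
- by rewrite (X0 _ x) !linear0.
by rewrite app_id => ->; exists 0; rewrite linear0.
Qed.

Lemma ses_to_zero X Y Z (f : hom X Y) (g : hom Y Z) :
  ses f g -> (forall i (z : trm Z i), z = 0) -> is_iso f.
Proof.
move=> fg Z0; apply/isoP; split; first exact: ses_mono fg.
by move=> i y; apply: ses_ker fg _ _ _; exact: Z0.
Qed.

(** Stated on elements: [P] is, degree by degree, the set of pairs with equal image in [Z]. *)
Definition is_pullback X Y Z P (u : hom X Z) (v : hom Y Z) (p : hom P X)
    (q : hom P Y) :=
  [/\ comp u p = comp v q,
      forall i x y, app u i x = app v i y -> exists z, app p i z = x /\ app q i z = y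
    & forall i z, app p i z = 0 -> app q i z = 0 -> z = 0].

Lemma is_pullback_sym X Y Z P (u : hom X Z) (v : hom Y Z) (p : hom P X)
    (q : hom P Y) : is_pullback u v p q -> is_pullback v u q p.
Proof.
case=> e ex0 inj0; split=> // [i y x e'|i z q0 p0]; last exact: inj0.
by have [z [<- <-]] := ex0 i x y (esym e'); exists z.
Qed.

Lemma pullback_ex X Y Z (u : hom X Z) (v : hom Y Z) :
  exists P (p : hom P X) (q : hom P Y), is_pullback u v p q.
Proof.
have [a [j [al aj sl sj e]]] := dsum_biproduct X Y.
have [w wE] := hom_sub (comp u a) (comp v (dsnd X Y)).
have [P [f [fm fP]]] := kernel_ex w.
exists P, (comp a f), (comp (dsnd X Y) f); split.
- apply: hom_ext => i x; rewrite !app_comp; apply/eqP; rewrite -subr_eq0.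
  rewrite -(app_comp u a) -(app_comp v (dsnd X Y)) -wE.
  by apply/eqP/fP; exists x.
- move=> i x y uv.
  have /fP[z fz] : app w i (app (dinl X Y) i x + app j i y) = 0.
    by rewrite wE !app_comp !linearD /= al aj sl sj !linear0 addr0 add0r uv subrr.
  exists z; rewrite !app_comp fz !linearD /= al aj sl sj.
  by rewrite addr0 add0r.
- move=> i z; rewrite !app_comp => a0 s0; apply: fm.
  by rewrite (e _ (app f i z)) a0 s0 !linear0 addr0.
Qed.

(** The kernel of [q] is carried by [p] isomorphically onto the kernel of [g]. The pullback is given
    rather than constructed, so that one and the same [P] can be used along both of its
    projections. *)
Lemma ses_is_pullback X Y Z W P (f : hom X Y) (g : hom Y Z) (u : hom W Z)
    (p : hom P Y) (q : hom P W) : ses f g -> is_pullback g u p q ->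
  exists f' : hom X P, ses f' q /\ comp p f' = f.
Proof.
move=> fg [e ex0 inj0].
have [P0 [j [jm jP]]] := kernel_ex q.
have pj_mono : mono (comp p j).
  apply/monoP => i x; rewrite app_comp => pj0; apply: jm; rewrite linear0.
  by apply: inj0 => //; apply/jP; exists x.
have [|h hP] := hom_lift (v := f) pj_mono.
  move=> i x; have [|z [pz qz]] := ex0 i (app f i x) 0.
    by rewrite linear0 (ses_zero fg).
  by have /jP[t jt] := qz; exists t; rewrite app_comp jt.
exists (comp j h); split; last by rewrite compA.
have fE i x : app p i (app j i (app h i x)) = app f i x.
  by rewrite -(app_eq hP) app_comp.
apply: ses_intro.
- apply/monoP => i x; rewrite app_comp => jh0; apply: (ses_mono fg).
  by rewrite -!fE jh0 !linear0.
- move=> i w; have [y gy] := ses_epi fg (app u i w).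
  by have [z [_ qz]] := ex0 i y w gy; exists z.
- by move=> i x; rewrite app_comp; apply/jP; exists (app h i x).
move=> i z qz; have /(ses_ker fg)[x fx] : app g i (app p i z) = 0.
  by rewrite (app_eq e) app_comp qz linear0.
exists x; rewrite app_comp; apply/eqP; rewrite -subr_eq0; apply/eqP.
apply: inj0; first by rewrite linearB /= fE fx subrr.
by rewrite linearB /= qz subr0; apply/jP; exists (app h i x).
Qed.

Lemma ses_pullback X Y Z W (f : hom X Y) (g : hom Y Z) (u : hom W Z) : ses f g ->
  exists P (f' : hom X P) (q : hom P W) (p : hom P Y),
    [/\ ses f' q, comp p f' = f & comp g p = comp u q].
Proof.
move=> fg; have [P [p [q pq]]] := pullback_ex g u.
have [f' [f'q pf']] := ses_is_pullback fg pq.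
by exists P, f', q, p; split=> //; case: pq.
Qed.

(** The pushout is the cokernel of (u, -f) from [X] to the sum of [W] and [Y]. *)
Lemma ses_pushout X Y Z W (f : hom X Y) (g : hom Y Z) (u : hom X W) : ses f g ->
  exists P (j : hom W P) (g' : hom P Z) (p : hom Y P),
    [/\ ses j g', comp p f = comp j u & comp g' p = g].
Proof.
move=> fg; have [a [j [al aj sl sj e]]] := dsum_biproduct W Y.
pose s := dsnd W Y; pose l := dinl W Y.
have [w wE] := hom_sub (comp l u) (comp j f).
have [P [c [ce cP]]] := cokernel_ex w.
have cw i x : app c i (app l i (app u i x)) = app c i (app j i (app f i x)).
  apply/eqP; rewrite -subr_eq0 -linearB; apply/eqP/cP.
  by exists x; rewrite wE !app_comp.
have [|g' g'E] := hom_desc (v := comp g s) ce.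
  move=> i y /cP[x <-]; rewrite wE !app_comp linearB /= sl sj sub0r.
  by rewrite linearN /= (ses_zero fg) oppr0.
have g'c i y : app g' i (app c i y) = app g i (app s i y).
  by rewrite (app_eq g'E) app_comp.
exists P, (comp c l), g', (comp c j); split.
- apply: ses_intro.
  + apply/monoP => i y; rewrite app_comp => /cP[x]; rewrite wE !app_comp => ex.
    have fx0 : app f i x = 0.
      have := congr1 (app s i) ex; rewrite linearB /= sl sj sub0r sl => /eqP.
      by rewrite oppr_eq0 => /eqP.
    have x0 : x = 0 by apply: (ses_mono fg); rewrite fx0 linear0.
    by move: ex; rewrite x0 !linear0 addr0 => /(congr1 (app a i)); rewrite linear0 al.
  + move=> i z; have [y <-] := ses_epi fg z; exists (app c i (app j i y)).
    by rewrite g'c sj.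
  + by move=> i x; rewrite app_comp g'c sl linear0.
  move=> i z; have [y <-] := ce i z; rewrite g'c => /(ses_ker fg)[x fx].
  exists (app a i y + app u i x); rewrite !app_comp [in RHS](e i y) -fx !linearD /=.
  by rewrite cw.
- by apply: hom_ext => i x; rewrite !app_comp -cw.
by apply: hom_ext => i x; rewrite !app_comp g'c sj.
Qed.

(** The kernel of a composite of epimorphisms is an extension of the kernel of the second by the
    kernel of the first. This is how kernels acquire further filtration steps. *)
Lemma ses_comp_epi X Y Z W V (f : hom X Y) (g : hom Y Z) (n : hom W Z)
    (m : hom Z V) : ses f g -> ses n m ->
  exists U (h : hom U Y) (a : hom X U) (b : hom U W),
    ses h (comp m g) /\ ses a b.
Proof.
move=> fg nm.
have mg_epi : epi (comp m g).
  move=> i v; have [z <-] := ses_epi nm v; have [y <-] := ses_epi fg z.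
  by exists y; rewrite app_comp.
have [U [h hmg]] := ses_of_epi mg_epi.
have [|a ha] := hom_lift (v := f) (ses_mono hmg).
  move=> i x; apply: (ses_ker hmg).
  by rewrite app_comp (ses_zero fg) linear0.
have [|b nb] := hom_lift (v := comp g h) (ses_mono nm).
  move=> i x; apply: (ses_ker nm).
  by rewrite app_comp -app_comp (ses_zero hmg).
have nbE i x : app n i (app b i x) = app g i (app h i x).
  by rewrite (app_eq nb) app_comp.
exists U, h, a, b; split=> //; apply: ses_intro.
- by apply/monoP => i x ax; apply: (ses_mono fg); rewrite -(app_eq ha) ax !linear0.
- move=> i w; have [y gy] := ses_epi fg (app n i w).
  have [|u hu] := ses_ker hmg (i := i) (y := y).
    by rewrite app_comp gy (ses_zero nm).
  by exists u; apply: (ses_mono nm); rewrite nbE hu.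
- by move=> i x; apply: (ses_mono nm); rewrite nbE (app_eq ha) (ses_zero fg) linear0.
move=> i u bu; have [|x fx] := ses_ker fg (i := i) (y := app h i u).
  by rewrite -nbE bu linear0.
by exists x; apply: (ses_mono hmg); rewrite (app_eq ha).
Qed.

(** Since [comp p m] is a monomorphism, [X] meets the kernel [W] of [p] in 0. Hence [W] embeds in Z
    = Y/X, and the quotient is Y/(X + W) = P/X = Q. *)
Lemma ses_3x3 X Y Z W P Q (m : hom X Y) (c : hom Y Z) (l : hom W Y) (p : hom Y P)
    (q : hom P Q) : ses m c -> ses l p -> ses (comp p m) q ->
  exists (a : hom W Z) (b : hom Z Q), ses a b.
Proof.
move=> mc lp pmq.
have [|b bc] := hom_desc (v := comp q p) (ses_epi mc).
  move=> i y /(ses_ker mc)[x <-]; rewrite app_comp -(app_comp p m).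
  exact: ses_zero pmq _ _.
have bcE i y : app b i (app c i y) = app q i (app p i y).
  by rewrite (app_eq bc) app_comp.
exists (comp c l), b; apply: ses_intro.
- apply/monoP => i w; rewrite app_comp => /(ses_ker mc)[x mx].
  have x0 : x = 0.
    by apply: (ses_mono pmq); rewrite app_comp mx (ses_zero lp) linear0.
  by apply: (ses_mono lp); rewrite -mx x0 !linear0.
- move=> i z; have [t <-] := ses_epi pmq z; have [y <-] := ses_epi lp t.
  by exists (app c i y).
- by move=> i w; rewrite app_comp bcE (ses_zero lp) linear0.
move=> i z; have [y <-] := ses_epi mc z; rewrite bcE => /(ses_ker pmq)[x].
rewrite app_comp => e; have [|w lw] := ses_ker lp (i := i) (y := y - app m i x).
  by rewrite linearB /= e subrr.
by exists w; rewrite app_comp lw linearB /= (ses_zero mc) subr0.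
Qed.

Lemma iso_middle X Y Z X' Y' Z' (f : hom X Y) (g : hom Y Z) (f' : hom X' Y')
    (g' : hom Y' Z') (a : hom X X') (b : hom Y Y') (c : hom Z Z') :
    ses f g -> ses f' g' -> comp b f = comp f' a -> comp g' b = comp c g ->
  is_iso a -> is_iso c -> is_iso b.
Proof.
move=> fg fg' bf gb /isoP[am ae] /isoP[cm ce].
have bfE i x : app b i (app f i x) = app f' i (app a i x).
  by rewrite (app_eq bf) app_comp.
have gbE i y : app g' i (app b i y) = app c i (app g i y).
  by rewrite (app_eq gb) app_comp.
apply/isoP; split.
  apply/monoP => i y by0.
  have [|x fx] := ses_ker fg (i := i) (y := y).
    by apply: cm; rewrite -gbE by0 !linear0.
  rewrite -fx; suff -> : x = 0 by rewrite linear0.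
  by apply/am/(ses_mono fg'); rewrite -bfE fx by0 !linear0.
move=> i y'; have [z cz] := ce i (app g' i y').
have [y gy] := ses_epi fg z.
have [|x' fx'] := ses_ker fg' (i := i) (y := y' - app b i y).
  by rewrite linearB /= gbE gy cz subrr.
have [x ax] := ae i x'; exists (app f i x + y).
by rewrite linearD /= bfE ax fx' subrK.
Qed.

End Diagrams.

(** * First extension groups and cotorsion pairs *)

Section Ext.
Variables (k : ambient) (R : comPzRingType).
Implicit Types X Y Z W P Q : K k R.
Implicit Types (E A B L : K k R -> Prop).

(** The map id - f r kills the image of [f], so it factors through [g] as a section; dually id - t g
    lands in the image of [f]. *)
Lemma retraction_section X Y Z (f : hom X Y) (g : hom Y Z) : ses f g ->
  (exists r, comp r f = idm X) <-> (exists t, comp g t = idm Z).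
Proof.
move=> fg; split=> -[].
  move=> r rf; have [d dE] := hom_sub (idm Y) (comp f r).
  have [|t tg] := hom_desc (v := d) (ses_epi fg).
    move=> i y /(ses_ker fg)[x <-].
    by rewrite dE app_id app_comp (app_eq_id rf) subrr.
  exists t; apply: hom_ext => i z; have [y <-] := ses_epi fg z.
  rewrite app_comp (app_eq tg) dE app_id app_comp linearB /= (ses_zero fg).
  by rewrite subr0 app_id.
move=> t gt; have [d dE] := hom_sub (idm Y) (comp t g).
have [|r fr] := hom_lift (v := d) (ses_mono fg).
  move=> i y; apply: (ses_ker fg).
  by rewrite dE app_id app_comp linearB /= (app_eq_id gt) subrr.
exists r; apply: hom_ext => i x; apply: (ses_mono fg).
by rewrite app_comp (app_eq fr) dE !app_id app_comp (ses_zero fg) linear0 subr0.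
Qed.

Lemma retraction_iso_dsum X Y Z (f : hom X Y) (g : hom Y Z) (r : hom Y X) :
    ses f g -> comp r f = idm X ->
  exists h : hom Y (dsum X Z),
    [/\ is_iso h, comp h f = dinl X Z & comp (dsnd X Z) h = g].
Proof.
move=> fg rf; have [p [j [pl pj sl sj e]]] := dsum_biproduct X Z.
have [h hE] := hom_add (comp (dinl X Z) r) (comp j g).
have hf i x : app h i (app f i x) = app (dinl X Z) i x.
  by rewrite hE !app_comp (app_eq_id rf) (ses_zero fg) linear0 addr0.
have sh i y : app (dsnd X Z) i (app h i y) = app g i y.
  by rewrite hE !app_comp linearD /= sl sj add0r.
exists h; split; last 2 first.
- by apply: hom_ext => i x; rewrite app_comp.
- by apply: hom_ext => i x; rewrite app_comp.
apply: (iso_middle (f := f) (g := g) (f' := dinl X Z) (g' := dsnd X Z)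
  (a := idm X) (c := idm Z)) => //; try exact: iso_id; try exact: ses_dsum.
  by apply: hom_ext => i x; rewrite !app_comp app_id.
by apply: hom_ext => i x; rewrite !app_comp app_id.
Qed.

Lemma retraction_summand X Y Z (f : hom X Y) (g : hom Y Z) (r : hom Y X) :
  ses f g -> comp r f = idm X -> direct_summand X Y.
Proof.
by move=> fg rf; have [h [hi _ _]] := retraction_iso_dsum fg rf; exists Z, h.
Qed.

Lemma summand_retract X Y : direct_summand X Y ->
  exists (i : hom X Y) (q : hom Y X), comp q i = idm X.
Proof.
case=> Z [h [h' [h'h hh']]]; have [p [j [pl _ _ _ _]]] := dsum_biproduct X Z.
exists (comp h' (dinl X Z)), (comp p h); apply: hom_ext => i x.
by rewrite !app_comp (app_eq_id hh') pl app_id.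
Qed.

(** Replaces equivalence with the trivial extension by a one-sided inverse, which is easier to
    transport through pullbacks, pushouts and localization. *)
Lemma Ext1_retraction E Z X : Ext1_vanishes E Z X <->
  forall Y (f : hom X Y) (g : hom Y Z), admissible E f g ->
    exists r, comp r f = idm X.
Proof.
split=> ext Y f g fg.
  have [h [_ hf _]] := ext Y f g fg.
  have [p [_ [pl _ _ _ _]]] := dsum_biproduct X Z.
  exists (comp p h); apply: hom_ext => i x.
  by rewrite !app_comp (app_eq hf) pl app_id.
have [r rf] := ext Y f g fg.
by case: fg => _ _ _ fg; exact: retraction_iso_dsum fg rf.
Qed.

Lemma Ext1_section E Z X : Ext1_vanishes E Z X <->
  forall Y (f : hom X Y) (g : hom Y Z), admissible E f g ->
    exists t, comp g t = idm Z.
Proof.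
split=> [/Ext1_retraction ext Y f g fg|ext].
  have [_ _ _ fg'] := fg.
  exact: (retraction_section fg').1 (ext Y f g fg).
apply/Ext1_retraction => Y f g fg; have [_ _ _ fg'] := fg.
exact: (retraction_section fg').2 (ext Y f g fg).
Qed.

Lemma extension_mid L X Y Z (f : hom X Y) (g : hom Y Z) :
  extension_closed L -> ses f g -> L X -> L Z -> L Y.
Proof. by case=> _ Lext fg LX LZ; exact: Lext fg LX LZ. Qed.

Section ExtensionClosed.
Variables (E : K k R -> Prop) (E_ext : extension_closed E).

(* Pushing [f] out to [X''] gives a map [W -> X''] extending [b]; its kernel is an
   extension of [Y] by [X'], and a section of it is a section of [W -> Y]. *)
Lemma Ext1_extension_r Y X X' X'' (a : hom X' X) (b : hom X X'') :
    ses a b -> E X' -> E X'' ->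
  Ext1_vanishes E Y X' -> Ext1_vanishes E Y X'' -> Ext1_vanishes E Y X.
Proof.
move=> ab EX' EX'' /Ext1_section ext' /Ext1_retraction ext''.
apply/Ext1_section => W f g [EX EW EY fg].
have [P [f'' [g'' [p [f''g'' pf g''p]]]]] := ses_pushout b fg.
have [|r rf] := ext'' _ _ _ (_ : admissible E f'' g'').
  by split=> //; exact: (extension_mid E_ext f''g'').
have rpf i x : app (comp r p) i (app f i x) = app b i x.
  by rewrite app_comp (app_eq pf) app_comp (app_eq_id rf).
have [V [l lrp]] : exists V (l : hom V W), ses l (comp r p).
  by apply: ses_of_epi => i z; have [x <-] := ses_epi ab z; exists (app f i x).
have [|f' lf'] := hom_lift (v := comp f a) (ses_mono lrp).
  move=> i x; apply: (ses_ker lrp).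
  by rewrite [app (comp f a) _ _]app_comp rpf (ses_zero ab).
have f'g' : ses f' (comp g l).
  apply: ses_intro.
  - apply/monoP => i x f'x; apply/(ses_mono ab)/(ses_mono fg).
    by rewrite -app_comp -(app_eq lf') f'x !linear0.
  - move=> i y; have [w <-] := ses_epi fg y.
    have [x bx] := ses_epi ab (app (comp r p) i w).
    have [|v lv] := ses_ker lrp (i := i) (y := w - app f i x).
      by rewrite linearB /= rpf bx subrr.
    by exists v; rewrite app_comp lv linearB /= (ses_zero fg) subr0.
  - by move=> i x; rewrite app_comp (app_eq lf') app_comp (ses_zero fg).
  move=> i v; rewrite app_comp => /(ses_ker fg)[x fx].
  have [|x' ax'] := ses_ker ab (i := i) (y := x).
    by rewrite -rpf fx (ses_zero lrp).
  by exists x'; apply: (ses_mono lrp); rewrite (app_eq lf') app_comp ax'.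
have [|t glt] := ext' _ _ _ (_ : admissible E f' (comp g l)).
  by split=> //; exact: (extension_mid E_ext f'g').
by exists (comp l t); rewrite compA.
Qed.

(* Dually: a section [Y' -> W] over [a] is divided out, which leaves an extension
   of [Y''] by [X]. *)
Lemma Ext1_extension_l X Y Y' Y'' (a : hom Y' Y) (b : hom Y Y'') :
    ses a b -> E Y' -> E Y'' ->
  Ext1_vanishes E Y' X -> Ext1_vanishes E Y'' X -> Ext1_vanishes E Y X.
Proof.
move=> ab EY' EY'' /Ext1_section ext' /Ext1_retraction ext''.
apply/Ext1_retraction => W f g [EX EW EY fg].
have [V [f1 [g1 [p [f1g1 pf1 gp]]]]] := ses_pullback a fg.
have [|t g1t] := ext' _ _ _ (_ : admissible E f1 g1).
  by split=> //; exact: (extension_mid E_ext f1g1).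
have gpt i y : app g i (app (comp p t) i y) = app a i y.
  by rewrite app_comp (app_eq gp) app_comp (app_eq_id g1t).
have [Q [c ptc]] : exists Q (c : hom W Q), ses (comp p t) c.
  apply: ses_of_mono; apply/monoP => i y pt0; apply: (ses_mono ab).
  by rewrite -gpt pt0 !linear0.
have [|g2 g2c] := hom_desc (v := comp b g) (ses_epi ptc).
  by move=> i w /(ses_ker ptc)[y <-]; rewrite app_comp gpt (ses_zero ab).
have g2cE i w : app g2 i (app c i w) = app b i (app g i w).
  by rewrite (app_eq g2c) app_comp.
have f2g2 : ses (comp c f) g2.
  apply: ses_intro.
  - apply/monoP => i x; rewrite app_comp => /(ses_ker ptc)[y pty].
    have y0 : y = 0 by apply: (ses_mono ab); rewrite -gpt pty (ses_zero fg) linear0.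
    by apply: (ses_mono fg); rewrite -pty y0 !linear0.
  - move=> i z; have [y <-] := ses_epi ab z; have [w <-] := ses_epi fg y.
    by exists (app c i w); rewrite g2cE.
  - by move=> i x; rewrite app_comp g2cE (ses_zero fg) linear0.
  move=> i z; have [w <-] := ses_epi ptc z; rewrite g2cE => /(ses_ker ab)[y ay].
  have [|x fx] := ses_ker fg (i := i) (y := w - app (comp p t) i y).
    by rewrite linearB /= gpt ay subrr.
  by exists x; rewrite app_comp fx linearB /= (ses_zero ptc) subr0.
have [|r rcf] := ext'' _ _ _ (_ : admissible E (comp c f) g2).
  by split=> //; exact: (extension_mid E_ext f2g2).
by exists (comp r c); rewrite -compA.
Qed.

(** The extension is pushed out along [j], retracted there, and brought back by [q]. *)
Lemma Ext1_retract_r Y X X' (j : hom X X') (q : hom X' X) : comp q j = idm X ->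
  E X' -> Ext1_vanishes E Y X' -> Ext1_vanishes E Y X.
Proof.
move=> qj EX' /Ext1_retraction ext; apply/Ext1_retraction => W f g [EX EW EY fg].
have [P [f' [g' [p [f'g' pf _]]]]] := ses_pushout j fg.
have [|r rf'] := ext _ _ _ (_ : admissible E f' g').
  by split=> //; exact: (extension_mid E_ext f'g').
exists (comp q (comp r p)); apply: hom_ext => i x.
by rewrite !app_comp (app_eq pf) app_comp (app_eq_id rf') (app_eq_id qj) app_id.
Qed.

Lemma Ext1_retract_l X Y Y' (j : hom Y Y') (q : hom Y' Y) : comp q j = idm Y ->
  E Y' -> Ext1_vanishes E Y' X -> Ext1_vanishes E Y X.
Proof.
move=> qj EY' /Ext1_section ext; apply/Ext1_section => W f g [EX EW EY fg].
have [P [f' [g' [p [f'g' _ gp]]]]] := ses_pullback q fg.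
have [|t g't] := ext _ _ _ (_ : admissible E f' g').
  by split=> //; exact: (extension_mid E_ext f'g').
exists (comp p (comp t j)); apply: hom_ext => i x.
by rewrite !app_comp (app_eq gp) app_comp (app_eq_id g't) (app_eq_id qj) app_id.
Qed.

Lemma Ext1_zero_r Y X : (forall i (x : trm X i), x = 0) -> Ext1_vanishes E Y X.
Proof.
move=> X0; apply/Ext1_retraction => W f g _.
have [r _] := hom_zero W X.
by exists r; apply: hom_ext => i x; rewrite [LHS]X0 [RHS]X0.
Qed.

Lemma Ext1_zero_l Y X : (forall i (y : trm Y i), y = 0) -> Ext1_vanishes E Y X.
Proof.
move=> Y0; apply/Ext1_section => W f g _.
have [t _] := hom_zero Y W.
by exists t; apply: hom_ext => i x; rewrite [LHS]Y0 [RHS]Y0.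
Qed.

Lemma dsum_closed X Y : E X -> E Y -> E (dsum X Y).
Proof. exact: (extension_mid E_ext (ses_dsum X Y)). Qed.

End ExtensionClosed.

Section CotorsionClasses.
Variables (E A B : K k R -> Prop).
Hypotheses (E_ext : extension_closed E) (E_summand : summand_closed E).
Hypothesis AB : cotorsion_pair E A B.

Lemma cotorsion_r_extension_closed : extension_closed B.
Proof.
split=> [|X Y Z f g fg /AB.1[EX extX] /AB.1[EZ extZ]].
  apply/AB.1; split=> [|Y _]; first exact: E_ext.1.
  by apply: Ext1_zero_r => i x; exact: trm_zero.
apply/AB.1; split=> [|W AW]; first exact: (extension_mid E_ext fg).
exact: (Ext1_extension_r E_ext fg EX EZ (extX W AW) (extZ W AW)).
Qed.

Lemma cotorsion_l_extension_closed : extension_closed A.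
Proof.
split=> [|X Y Z f g fg /AB.2[EX extX] /AB.2[EZ extZ]].
  apply/AB.2; split=> [|Y _]; first exact: E_ext.1.
  by apply: Ext1_zero_l => i x; exact: trm_zero.
apply/AB.2; split=> [|W BW]; first exact: (extension_mid E_ext fg).
exact: (Ext1_extension_l E_ext fg EX EZ (extX W BW) (extZ W BW)).
Qed.

Lemma cotorsion_r_summand_closed : summand_closed B.
Proof.
move=> X Y XY /AB.1[EY extY]; have [j [q qj]] := summand_retract XY.
apply/AB.1; split=> [|W AW]; first exact: E_summand XY EY.
exact: (Ext1_retract_r E_ext qj EY (extY W AW)).
Qed.

Lemma cotorsion_l_summand_closed : summand_closed A.
Proof.
move=> X Y XY /AB.2[EY extY]; have [j [q qj]] := summand_retract XY.
apply/AB.2; split=> [|W BW]; first exact: E_summand XY EY.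
exact: (Ext1_retract_l E_ext qj EY (extY W BW)).
Qed.

End CotorsionClasses.

Section Filtrations.
Variable L : K k R -> Prop.

Lemma filtered_ind (P : K k R -> Prop) :
    iso_closed P -> P (zero_obj _) ->
    (forall X Y Q (f : hom X Y) (g : hom Y Q), ses f g -> P X -> L Q -> P Y) ->
  forall X, finitely_filtered L X -> P X.
Proof.
move=> Piso P0 Pext X [N [F [F0 FN step]]]; apply: (Piso _ _ FN).
elim: {-2}N (leqnn N) => [_|n IHn nN].
  exact: (Piso _ _ (isomorphic_sym F0)).
have [Q [f [g [fg LQ]]]] := step n nN.
exact: (Pext _ _ _ _ _ fg (IHn (ltnW nN))).
Qed.

Lemma filtered_zero X : isomorphic X (zero_obj _) -> finitely_filtered L X.
Proof. by move=> X0; exists 0%N, (fun=> X); split=> //; exact: isomorphic_refl. Qed.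

Lemma filtered_iso_closed : iso_closed (finitely_filtered L).
Proof.
move=> X Y XY [N [F [F0 FN step]]]; exists N, F; split=> //.
exact: isomorphic_trans FN XY.
Qed.

Lemma filtered_step X Y Q (f : hom X Y) (g : hom Y Q) :
  ses f g -> finitely_filtered L X -> L Q -> finitely_filtered L Y.
Proof.
move=> fg [N [F [F0 [h hi] step]]] LQ.
exists N.+1, (fun n => if (n <= N)%N then F n else Y); split=> //.
  by rewrite ltnn; exact: isomorphic_refl.
move=> i /[!ltnS] iN'; have [->|iN] : i = N \/ (i < N)%N.
  by apply/predU1P; rewrite -leq_eqVlt.
  (* The last old stage [F N] is only isomorphic to [X], whence the correction of [f] by [h]. *)
  rewrite /= leqnn ltnn; exists Q, (comp f h), g; split=> //.
  exact: ses_iso_l.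
by rewrite /= (ltnW iN) iN; exact: step.
Qed.

End Filtrations.

End Ext.

(** * Localization and restriction of scalars *)

Section FractionModules.
Variables (R : comPzRingType) (s : R).

Lemma frac_eq0 (M : lmodType R) (m : M) n :
  frac s m n = 0 <-> exists k, s ^+ k *: m = 0.
Proof.
split=> [/frac_eq[k]|[k sm]].
  by rewrite addn0 scaler0 => sm; exists k.
by apply/frac_eq; exists k; rewrite addn0 scaler0.
Qed.

Lemma to_loc_frac (M : lmodType R) r (m : M) n :
  to_loc s r *: frac s m n = frac s (r *: m) n.
Proof. by rewrite -fracZ. Qed.

Section LocalizedMap.
Variables (M N : lmodType R) (f : {linear M -> N}).

(** Injectivity is asked only up to powers of [s], and likewise surjectivity in the next lemma;
    iterated localizations need this generality. *)
Lemma loc_map_inj : (forall m, f m = 0 -> exists k, s ^+ k *: m = 0) ->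
  injective (loc_map f : localization s M -> localization s N).
Proof.
move=> f0; apply: raddf_inj => x; have [m [n ->]] := fracP x.
rewrite /= loc_mapE => /frac_eq0[k]; rewrite -linearZ => /f0[l e].
by apply/frac_eq0; exists (l + k)%N; rewrite exprD -scalerA.
Qed.

Lemma loc_map_surj : (forall y, exists k x, f x = s ^+ k *: y) ->
  forall y : localization s N, exists x, loc_map f x = y.
Proof.
move=> fs y; have [m [n ->]] := fracP y; have [k [x fx]] := fs m.
by exists (frac s x (k + n)); rewrite /= loc_mapE fx frac_expand.
Qed.

End LocalizedMap.

Lemma loc_map_ses (X Y Z : lmodType R) (f : {linear X -> Y}) (g : {linear Y -> Z}) :
  mod_ses f g ->
  mod_ses (loc_map f : {linear localization s X -> localization s Y}) (loc_map g).
Proof.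
case=> fi gs fg; split.
- apply: loc_map_inj => m fm; exists 0%N.
  by have -> : m = 0 by [apply: fi; rewrite fm linear0]; rewrite scaler0.
- by apply: loc_map_surj => z; have [y <-] := gs z; exists 0%N, y; rewrite scale1r.
move=> y; have [m [n ->]] := fracP y; rewrite /= loc_mapE; split.
  move=> /frac_eq0[k]; rewrite -linearZ => /fg[x fx].
  by exists (frac s x (k + n)); rewrite /= loc_mapE fx frac_expand.
case=> x; have [m' [n' ->]] := fracP x; rewrite /= loc_mapE => /frac_eq[k e].
apply/frac_eq0; exists (k + n')%N; rewrite -linearZ; apply/fg.
by exists (s ^+ (k + n) *: m'); rewrite linearZ.
Qed.

Section Unit.
Variable M : lmodType R.

Definition loc_unit_fun (m : M) : restriction (to_loc s) (localization s M) :=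
  frac s m 0.

Lemma loc_unit_linear : linear loc_unit_fun.
Proof. by move=> a x y; rewrite /loc_unit_fun fracD -to_loc_frac. Qed.

HB.instance Definition _ := GRing.isLinear.Build R M
  (restriction (to_loc s) (localization s M)) *:%R loc_unit_fun loc_unit_linear.

Definition loc_unit : {linear M -> restriction (to_loc s) (localization s M)} :=
  loc_unit_fun.

Lemma loc_unit_inj : (forall m : M, s *: m = 0 -> m = 0) -> injective loc_unit.
Proof.
move=> s0; apply: raddf_inj => m /frac_eq0[k].
elim: k => [|k IHk]; first by rewrite scale1r.
by rewrite exprS -scalerA => /s0.
Qed.

Lemma loc_unit_surj : (forall m : M, exists m', s *: m' = m) ->
  forall y, exists m, loc_unit m = y.
Proof.
move=> sM y; have [m [n ->]] := fracP (y : localization s M).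
elim: n m => [|n IHn] m; first by exists m.
have [m' <-] := sM m; have [x xE] := IHn m'; exists x; rewrite xE.
by rewrite -(frac_expand s m' n 1) expr1.
Qed.

End Unit.

Lemma loc_counit_ex (N : lmodType (loc_ring s)) :
  exists g : {linear localization s (restriction (to_loc s) N) -> N},
    forall x n, g (frac s x n) = rfrac s 1 n *: (x : N).
Proof.
have [g [gE _]] := localization_base_change (N := N)
  (idfun : {linear restriction (to_loc s) N -> restriction (to_loc s) N}).
exists g => x n; transitivity (rfrac s 1 n *: g (frac s x 0)); last by rewrite gE.
by rewrite -linearZ -fracZ scale1r addn0.
Qed.

End FractionModules.

(** Instead of showing that powers of the [s j] generate the unit ideal, the terms of x = sum (c_j
    s_j) x are removed one by one: [s j *: x] satisfies the same hypotheses with a smaller exponent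
    at [j], so it vanishes by induction and the j-th term drops out. *)
Lemma unit_ideal_torsion (R : comPzRingType) (d : nat) (s : 'I_d -> R)
    (M : lmodType R) (m : M) : unit_ideal s ->
  (forall j, exists k, s j ^+ k *: m = 0) -> m = 0.
Proof.
case=> c c1.
suff tors (r : seq 'I_d) : forall x : M, (forall j, exists k, s j ^+ k *: x = 0) ->
    x = \sum_(j <- r) (c j * s j) *: x -> x = 0.
  by move=> mt; apply: (tors (index_enum _)) => //; rewrite -scaler_suml c1 scale1r.
elim: r => [|j r IHr] x xt; first by rewrite big_nil.
have [k] := xt j; elim: k x xt => [|k IHk] x xt; first by rewrite scale1r.
rewrite exprSr -scalerA => sx xE.
have comm a b (y : M) : a *: (b *: y) = b *: (a *: y) by rewrite !scalerA mulrC.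
have sx0 : s j *: x = 0.
  apply: IHk => // [i|].
    by have [l e] := xt i; exists l; rewrite comm e scaler0.
  rewrite {1}xE scaler_sumr; apply: eq_bigr => i _; exact: comm.
by apply: IHr => //; move: xE; rewrite big_cons -scalerA sx0 scaler0 add0r.
Qed.

Lemma cx_loc_map_proof (R : comPzRingType) (s : R) (X Y : complex R) (f : chmap X Y)
    (n : int) (x : cx_loc s X n) :
  loc_map (f (n + 1)) (diff (cx_loc s X) n x) =
  diff (cx_loc s Y) n (loc_map (f n) x).
Proof. by have [m [p ->]] := fracP x; rewrite /= !loc_mapE chmapP. Qed.

Definition Kloc_map (k : ambient) (R : comPzRingType) (s : R) :
    forall X Y : K k R, hom X Y -> hom (Kloc s X) (Kloc s Y) :=
  match k with
  | Modules => fun X Y f => loc_map f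
  | Complexes => fun X Y f =>
      @Chmap _ (cx_loc s X) (cx_loc s Y) (fun n => loc_map (f n))
        (cx_loc_map_proof f)
  end.

Definition Kres_map (k : ambient) (R : comPzRingType) (s : R) :
    forall X Y : K k (loc_ring s), hom X Y -> hom (Kres X) (Kres Y) :=
  match k with
  | Modules => fun X Y f => restr_map f
  | Complexes => fun X Y f =>
      @Chmap _ (cx_restr (to_loc s) X) (cx_restr (to_loc s) Y)
        (fun n => restr_map (f n)) (fun n x => chmapP f (x : X n))
  end.

Definition Kunit (k : ambient) (R : comPzRingType) (s : R) :
    forall X : K k R, hom X (Kres (Kloc s X)) :=
  match k return forall X : K k R, hom X (Kres (Kloc s X)) with
  | Modules => fun X => loc_unit s X
  | Complexes => fun X =>
      @Chmap _ X (cx_restr (to_loc s) (cx_loc s X)) (fun n => loc_unit s (X n))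
        (fun n x => esym (loc_mapE s (diff X n) x 0))
  end.

Section LocalizationFunctors.
Variables (k : ambient) (R : comPzRingType).

Section OneElement.
Variable s : R.
Implicit Types (X Y Z : K k R) (N : K k (loc_ring s)).

Lemma Kloc_ses X Y Z (f : hom X Y) (g : hom Y Z) :
  ses f g -> ses (Kloc_map s f) (Kloc_map s g).
Proof.
case: k X Y Z f g => X Y Z f g; first exact: loc_map_ses.
by move=> fg n; exact: loc_map_ses (fg n).
Qed.

Lemma Kloc_comp X Y Z (g : hom Y Z) (f : hom X Y) :
  Kloc_map s (comp g f) = comp (Kloc_map s g) (Kloc_map s f).
Proof.
apply: hom_ext => i x; case: k X Y Z g f i x => X Y Z g f i x;
  by have [m [n ->]] := fracP x; rewrite /= !loc_mapE.
Qed.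

Lemma Kres_ses N N' N'' (f : hom N N') (g : hom N' N'') :
  ses f g -> ses (Kres_map f) (Kres_map g).
Proof. by case: k N N' N'' f g. Qed.

Lemma Kres_id N : Kres_map (idm N) = idm (Kres N).
Proof. by apply: hom_ext; case: k N. Qed.

Lemma Kres_comp N N' N'' (g : hom N' N'') (f : hom N N') :
  Kres_map (comp g f) = comp (Kres_map g) (Kres_map f).
Proof. by apply: hom_ext; case: k N N' N'' f g. Qed.

Lemma Kunit_nat X Y (f : hom X Y) :
  comp (Kunit s Y) f = comp (Kres_map (Kloc_map s f)) (Kunit s X).
Proof.
by apply: hom_ext; case: k X Y f => X Y f i x;
  rewrite /= /loc_unit_fun /restr_map loc_mapE.
Qed.

(** Uniqueness in the adjunction: the fractions m/1 generate the localization over [loc_ring s].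
    Maps out of a localization are compared in this way throughout. *)
Lemma Kunit_eq X N (f g : hom (Kloc s X) N) :
  comp (Kres_map f) (Kunit s X) = comp (Kres_map g) (Kunit s X) -> f = g.
Proof.
move=> e; apply: hom_ext => i x.
have {}e j y : app (comp (Kres_map f) (Kunit s X)) j y =
  app (comp (Kres_map g) (Kunit s X)) j y by rewrite e.
case: k X N f g i x e => X N f g i x e; have [m [n ->]] := fracP x.
  have fE : f (frac s m 0) = g (frac s m 0) := e tt m.
  have -> : frac s m n = rfrac s 1 n *: frac s m 0 by rewrite -fracZ scale1r addn0.
  by rewrite /= !linearZ /= fE.
have fE : f i (frac s m 0) = g i (frac s m 0) := e i m.
have -> : frac s m n = rfrac s 1 n *: frac s m 0 by rewrite -fracZ scale1r addn0.
by rewrite /= !linearZ /= fE.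
Qed.

(** The counit x/s^n |-> s^-n x is bijective because [s] already acts invertibly on [N]; the second
    clause is a triangle identity. *)
Lemma Kcounit_ex N : exists e : hom (Kloc s (Kres N)) N,
  is_iso e /\ comp (Kres_map e) (Kunit s (Kres N)) = idm (Kres N).
Proof.
have counit_bij (M : lmodType (loc_ring s))
    (g : {linear localization s (restriction (to_loc s) M) -> M}) :
  (forall x n, g (frac s x n) = rfrac s 1 n *: (x : M)) ->
  injective g /\ forall y, exists x, g x = y.
  move=> gE; split=> [|y]; last first.
    exists (frac s (y : restriction (to_loc s) M) 0); rewrite gE.
    exact: scale1r.
  apply: raddf_inj => z; have [x [n ->]] := fracP z; rewrite /= gE => e.
  have x0 : x = 0.
    have := congr1 (fun y : M => to_loc s (s ^+ n) *: y) e.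
    by rewrite scaler0 scalerA mulrC rfrac_inv scale1r.
  by rewrite x0 frac0.
case: k N => N.
  have [g gE] := loc_counit_ex N; have [gi gs] := counit_bij _ g gE.
  exists g; split; first by apply/isoP; split=> i.
  apply: hom_ext => i x; rewrite app_comp app_id.
  exact: (etrans (gE x 0%N) (scale1r (x : N))).
have [g gE] := dependent_choice (fun n => loc_counit_ex (N n)).
have gd n (x : cx_loc s (cx_restr (to_loc s) N) n) :
    g (n + 1) (diff (cx_loc s (cx_restr (to_loc s) N)) n x) = diff N n (g n x).
  have [m [p ->]] := fracP x; by rewrite /= loc_mapE !gE [RHS]linearZ.
exists (@Chmap _ (cx_loc s (cx_restr (to_loc s) N)) N g gd); split.
  by apply/isoP; split=> i; have [] := counit_bij _ _ (gE i).
apply: hom_ext => i x; rewrite app_comp app_id.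
exact: (etrans (gE i x 0%N) (scale1r (x : N i))).
Qed.

Lemma adjoint_ex X N (f : hom X (Kres N)) :
  exists g : hom (Kloc s X) N, comp (Kres_map g) (Kunit s X) = f.
Proof.
have [e [_ eK]] := Kcounit_ex N; exists (comp e (Kloc_map s f)).
by rewrite Kres_comp -compA -Kunit_nat compA eK comp1m.
Qed.

End OneElement.

Lemma Kunit_joint_inj d (s : 'I_d -> R) (X : K k R) i (x : trm X i) :
  unit_ideal s -> (forall j, app (Kunit (s j) X) i x = 0) -> x = 0.
Proof.
case: k X i x => X i x us x0; apply: (unit_ideal_torsion us) => j;
  exact: (frac_eq0 (s j) _ 0).1 (x0 j).
Qed.

Section TwoElements.
Variables s t : R.

(** As [t] acts bijectively on M[t^-1], the kernel and cokernel of [phi] are torsion for [t'], and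
    [t'] acts bijectively on the target of [phi], which is therefore its own localization. *)
Lemma loc_loc_map_bij (M : lmodType R) :
  let phi := loc_map (loc_unit t M) :
    {linear localization s M -> localization s (restriction (to_loc t) (localization t M))} in
  let t' := to_loc s t in
  [/\ injective (loc_map phi : localization t' _ -> localization t' _),
      forall y : localization t' _, exists x, loc_map phi x = y,
      injective (loc_unit t' (localization s (restriction (to_loc t) (localization t M))))
    & forall y, exists x,
        loc_unit t' (localization s (restriction (to_loc t) (localization t M))) x = y].
Proof.
move=> phi t'; set Mt := restriction (to_loc t) (localization t M).
have tXE n (X : lmodType R) (x : X) m :
    t' ^+ n *: frac s x m = frac s (t ^+ n *: x) m.
  by rewrite -rmorphXn to_loc_frac.
have tMt (x : Mt) : t *: x = 0 -> x = 0.
  have [m [n ->]] := fracP (x : localization t M).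
  rewrite [t *: _](to_loc_frac t t m n) => /frac_eq0[l e].
  by apply/frac_eq0; exists l.+1; rewrite exprSr -scalerA.
have Mtt (x : Mt) : exists y, t *: y = x.
  have [m [n ->]] := fracP (x : localization t M).
  exists (frac t m n.+1); rewrite [t *: _](to_loc_frac t t m n.+1).
  by have := frac_expand t m n 1; rewrite expr1.
split.
- apply: loc_map_inj => x; have [m [b ->]] := fracP x.
  rewrite /phi /= loc_mapE => /frac_eq0[n]; rewrite -linearZ => /frac_eq0[l e].
  exists l; rewrite tXE; apply/frac_eq0; exists n.
  by rewrite scalerA mulrC -scalerA.
- apply: loc_map_surj => y; have [z [b ->]] := fracP y.
  have [m [a zE]] := fracP (z : localization t M).
  exists a, (frac s m b); rewrite /phi /= loc_mapE tXE; congr frac.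
  rewrite zE [RHS](to_loc_frac t (t ^+ a) m a).
  by have := frac_expand t m 0 a; rewrite addn0.
- apply: loc_unit_inj => y; have [z [b ->]] := fracP y.
  rewrite to_loc_frac => /frac_eq0[l]; rewrite scalerA mulrC -scalerA => /tMt e.
  by apply/frac_eq0; exists l.
apply: loc_unit_surj => y; have [z [b ->]] := fracP y.
by have [z' <-] := Mtt z; exists (frac s z' b); rewrite to_loc_frac.
Qed.

(* A system of classes need not be invariant under ring isomorphisms, so the
   double localizations over the distinct types R[s^-1][t^-1] and R[t^-1][s^-1]
   are compared over R[s^-1] only. *)
Lemma Kloc_Kres_Kloc (X : K k R) :
  isomorphic (Kres (Kloc (to_loc s t) (Kloc s X))) (Kloc s (Kres (Kloc t X))).
Proof.
set Y := Kloc s (Kres (Kloc t X)).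
have iso1 : is_iso (Kres_map (Kloc_map (to_loc s t) (Kloc_map s (Kunit t X)))).
  apply/isoP; case: k X @Y => X Y.
    by have [] := loc_loc_map_bij X; split=> i.
  by split=> i; have [] := loc_loc_map_bij (X i).
have [f fi] : isomorphic (Kres (Kloc (to_loc s t) Y)) Y.
  apply: isomorphic_sym; exists (Kunit (to_loc s t) Y).
  apply/isoP; rewrite /Y; case: k X {Y iso1} => X.
    by have [] := loc_loc_map_bij X; split=> i.
  by split=> i; have [] := loc_loc_map_bij (X i).
exists (comp f (Kres_map (Kloc_map (to_loc s t) (Kloc_map s (Kunit t X))))).
exact: iso_comp.
Qed.

End TwoElements.

End LocalizationFunctors.

Lemma dsum_pairing (k : ambient) (R : comPzRingType) (X Y : K k R) :
  exists (p : hom (dsum X Y) X) (j : hom Y (dsum X Y)), ses j p /\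
    forall W (a : hom W X) (b : hom W Y),
      exists h, comp p h = a /\ comp (dsnd X Y) h = b.
Proof.
have [p [j [pl pj sl sj e]]] := dsum_biproduct X Y.
exists p, j; split.
  apply: ses_intro => [||//|].
  - by move=> i; exact: can_inj (sj i).
  - by move=> i x; exists (app (dinl X Y) i x).
  by move=> i z z0; exists (app (dsnd X Y) i z); rewrite [RHS]e z0 linear0 add0r.
move=> W a b; have [h hE] := hom_add (comp (dinl X Y) a) (comp j b).
exists h; split; apply: hom_ext => i x; rewrite app_comp hE !app_comp linearD /=.
  by rewrite pl pj addr0.
by rewrite sl sj add0r.
Qed.

Lemma big_dsum_closed (k : ambient) (R : comPzRingType) (L : K k R -> Prop)
    (I : Type) (r : seq I) (F : I -> K k R) :
  extension_closed L -> (forall i, L (F i)) ->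
  L (\big[@dsum (K k R)/zero_obj (K k R)]_(i <- r) F i).
Proof.
move=> Lext LF; apply: big_ind => // [|X Y LX LY]; first exact: Lext.1.
exact: dsum_closed.
Qed.

(** * The adjunction on first extension groups *)

Section Adjunction.
Variables (k : ambient) (R : comPzRingType) (s : R).
Variables (E : K k R -> Prop) (Es : K k (loc_ring s) -> Prop).

(** The extension is localized, its kernel being identified with [N] by the counit; a retraction
    over R[s^-1] precomposed with the unit of [W] is one over R. *)
Lemma Ext1_Kres (M : K k R) (N : K k (loc_ring s)) :
    (forall X, E X -> Es (Kloc s X)) -> Es N ->
  Ext1_vanishes Es (Kloc s M) N -> Ext1_vanishes E M (Kres N).
Proof.
move=> asc EN /Ext1_retraction ext; apply/Ext1_retraction => W f g [_ EW EM fg].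
have [e [[e' [e'e ee']] eK]] := Kcounit_ex N.
have [|r rf] := ext _ _ _ (_ : admissible Es (comp (Kloc_map s f) e') (Kloc_map s g)).
  split; [exact: EN | exact: asc | exact: asc |].
  by apply: ses_iso_l (Kloc_ses s fg) _; exists e.
have rfe : comp r (Kloc_map s f) = e.
  by rewrite -[LHS]compm1 -e'e compA -(compA r) rf comp1m.
exists (comp (Kres_map r) (Kunit s W)).
by rewrite -compA Kunit_nat compA -Kres_comp rfe.
Qed.

(** The restricted extension is pulled back along M -> M[s^-1] and split over [M]; the adjunct of
    the resulting map M -> W is a section, as is seen on [M]. *)
Lemma Ext1_Kloc (M : K k R) (N : K k (loc_ring s)) :
    extension_closed E -> (forall X, Es X -> E (Kres X)) -> E M ->
  Ext1_vanishes E M (Kres N) -> Ext1_vanishes Es (Kloc s M) N.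
Proof.
move=> Eext dir EM /Ext1_section ext; apply/Ext1_section => W f g [EN EW _ fg].
have [P [f' [q [p [f'q _ gp]]]]] := ses_pullback (Kunit s M) (Kres_ses fg).
have [|t qt] := ext _ _ _ (_ : admissible E f' q).
  by split=> //; [exact: dir | exact: (extension_mid Eext f'q (dir _ EN) EM)].
have [v vE] := adjoint_ex (comp p t).
exists v; apply: Kunit_eq.
by rewrite Kres_comp -compA vE compA gp -compA qt compm1 Kres_id comp1m.
Qed.

End Adjunction.

(** * Embedding into a finite sum of restricted objects *)

Section Cech.
Variables (k : ambient) (RR : comPzRingType -> Prop).
(** Used with [E] for the antilocality of [B], and with [A] for the strong antilocality of the
    intersection. *)
Variable L : forall R : comPzRingType, K k R -> Prop.
Hypothesis L_ext : forall R, RR R -> extension_closed (@L R).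
Hypothesis L_very_local : very_local RR L.
Hypothesis RR_loc : forall (R : comPzRingType) (s : R), RR R -> RR (loc_ring s).
Variables (R : comPzRingType) (d : nat) (s : 'I_d -> R).
Hypotheses (RR_R : RR R) (s_unit : unit_ideal s).

(* After inverting [s j], the map [M -> D j] becomes [u j] and so [ses_3x3] shows
   the localized cokernel to be an extension of [Q j] by the localization of the
   kernel of the projection onto the [j]-th summand. *)
Lemma cech_embedding (M : K k R) (D Q : forall j, K k (loc_ring (s j)))
    (u : forall j, hom (Kloc (s j) M) (D j)) (q : forall j, hom (D j) (Q j)) :
    (forall j, ses (u j) (q j)) -> (forall j, L (D j)) -> (forall j, L (Q j)) ->
  exists (C : K k R)
      (m : hom M (\big[@dsum (K k R)/zero_obj (K k R)]_(j < d) Kres (D j)))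
      (c : hom _ C),
    ses m c /\ L C.
Proof.
move=> uq LD LQ; have [[asc desc] dir] := L_very_local.
pose w j := comp (Kres_map (u j)) (Kunit (s j) M).
(* The kernel [Z] of the j-th projection is carried along the list as an extension in [L], which
   avoids rewriting the sum without its j-th term. *)
have mP : forall r : seq 'I_d,
    exists m : hom M (\big[@dsum (K k R)/zero_obj (K k R)]_(j <- r) Kres (D j)),
    forall j, j \in r -> exists Z (l : hom Z _) (p : hom _ (Kres (D j))),
      [/\ ses l p, comp p m = w j & L Z].
  elim=> [|j0 r [m mP]].
    by rewrite big_nil; have [m _] := hom_zero M (zero_obj (K k R)); exists m.
  rewrite big_cons; have [p [a [ap pair]]] := dsum_pairing (Kres (D j0))
    (\big[@dsum (K k R)/zero_obj (K k R)]_(j <- r) Kres (D j)).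
  have [h [ph sh]] := pair M (w j0) m; exists h => j.
  rewrite inE; case: eqP => [-> _|_ /= jr].
    exists _, a, p; split=> //; apply: big_dsum_closed => [|i]; first exact: L_ext.
    exact: dir.
  have [Z [l [p' [lp' p'm LZ]]]] := mP j jr.
  have [U [b [n [o [bp' no]]]]] := ses_comp_epi (ses_dsum (Kres (D j0)) _) lp'.
  exists U, b, (comp p' (dsnd _ _)); split=> //.
    by rewrite -compA sh.
  exact: (extension_mid (L_ext RR_R) no (dir _ _ _ RR_R (LD j0)) LZ).
have {mP}[m mP] := mP (index_enum 'I_d).
have m_mono : mono m.
  apply/monoP => i x mx; apply: (Kunit_joint_inj s_unit) => j.
  have [Z [l [p [_ pm _]]]] := mP j (mem_index_enum j).
  apply: (ses_mono (Kres_ses (uq j))).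
  by rewrite linear0 -app_comp -[comp _ _]/(w j) -pm app_comp mx linear0.
have [C [c mc]] := ses_of_mono m_mono; exists C, m, c; split=> //.
apply: desc s_unit _ => // j.
have [Z [l [p [lp pm LZ]]]] := mP j (mem_index_enum j).
have [e [ei eK]] := Kcounit_ex (D j).
have lpj := ses_iso_r (Kloc_ses (s j) lp) ei.
have pmj : comp (comp e (Kloc_map (s j) p)) (Kloc_map (s j) m) = u j.
  apply: Kunit_eq.
  rewrite -compA -Kloc_comp pm Kres_comp -compA -Kunit_nat compA eK.
  by rewrite comp1m.
have uqj : ses (comp (comp e (Kloc_map (s j) p)) (Kloc_map (s j) m)) (q j).
  by rewrite pmj.
have [a [b ab]] := ses_3x3 (Kloc_ses (s j) mc) lpj uqj.
exact: (extension_mid (L_ext (RR_loc _ RR_R)) ab (asc _ _ _ RR_R LZ) (LQ j)).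
Qed.

End Cech.

(** * Local, very local and antilocal classes *)

Section CotorsionSystems.
Variables (k : ambient) (RR : comPzRingType -> Prop).
Variables (E A B : forall R : comPzRingType, K k R -> Prop).
Hypothesis RR_loc : forall (R : comPzRingType) (s : R), RR R -> RR (loc_ring s).
Hypothesis E_iso : forall R, RR R -> iso_closed (@E R).
Hypothesis A_iso : forall R, RR R -> iso_closed (@A R).
Hypothesis B_iso : forall R, RR R -> iso_closed (@B R).
Hypothesis E_ext : forall R, RR R -> extension_closed (@E R).
Hypothesis E_summand : forall R, RR R -> summand_closed (@E R).
Hypothesis E_very_local : very_local RR E.
Hypothesis A_sub_E : forall R (M : K k R), RR R -> A M -> E M.
Hypothesis B_sub_E : forall R (M : K k R), RR R -> B M -> E M.
Hypothesis AB_cotorsion : forall R, RR R ->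
  hereditary_complete_cotorsion_pair (@E R) (@A R) (@B R).

Let E_asc : ascent RR E := E_very_local.1.1.
Let E_desc : descent RR E := E_very_local.1.2.
Let E_dir : direct_image RR E := E_very_local.2.

Lemma cotorsion_of R : RR R -> cotorsion_pair (@E R) (@A R) (@B R).
Proof. by case/AB_cotorsion. Qed.

Lemma Ext1_AB R (M N : K k R) : RR R -> A M -> B N -> Ext1_vanishes (@E R) M N.
Proof. by move=> RR_R AM /(cotorsion_of RR_R).1[_]; exact. Qed.

Lemma A_extension_closed R : RR R -> extension_closed (@A R).
Proof.
move=> RR_R; exact: cotorsion_l_extension_closed (E_ext RR_R) (cotorsion_of RR_R).
Qed.

Lemma B_extension_closed R : RR R -> extension_closed (@B R).
Proof.
move=> RR_R; exact: cotorsion_r_extension_closed (E_ext RR_R) (cotorsion_of RR_R).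
Qed.

Lemma A_summand_closed R : RR R -> summand_closed (@A R).
Proof.
move=> RR_R.
exact: cotorsion_l_summand_closed (E_ext RR_R) (E_summand RR_R) (cotorsion_of RR_R).
Qed.

Lemma B_summand_closed R : RR R -> summand_closed (@B R).
Proof.
move=> RR_R.
exact: cotorsion_r_summand_closed (E_ext RR_R) (E_summand RR_R) (cotorsion_of RR_R).
Qed.

Lemma ascent_l_direct_image_r : ascent RR A -> direct_image RR B.
Proof.
move=> A_asc R s N RR_R BN; have RR_s := RR_loc s RR_R.
have EN := B_sub_E RR_s BN.
apply/(cotorsion_of RR_R).1; split=> [|M AM]; first exact: E_dir.
apply: (Ext1_Kres (Es := @E (loc_ring s))) => // [X EX|].
  exact: E_asc.
exact: Ext1_AB RR_s (A_asc _ _ _ RR_R AM) BN.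
Qed.

Lemma direct_image_r_ascent_l : direct_image RR B -> ascent RR A.
Proof.
move=> B_dir R s M RR_R AM; have RR_s := RR_loc s RR_R.
have EM := A_sub_E RR_R AM.
apply/(cotorsion_of RR_s).2; split=> [|N BN]; first exact: E_asc.
apply: (Ext1_Kloc (E := @E R)) => // [|X EX|].
- exact: E_ext.
- exact: E_dir.
exact: Ext1_AB RR_R AM (B_dir _ _ _ RR_R BN).
Qed.

(** Convertible to the predicate written out in [antilocal]. *)
Definition restricted_class (L : forall R : comPzRingType, K k R -> Prop)
    (R : comPzRingType) (d : nat) (s : 'I_d -> R) (Q : K k R) :=
  exists (j : 'I_d) (N : K k (loc_ring (s j))), L _ N /\ isomorphic Q (Kres N).

(** Antilocality is applied to the pair s, 1, which generates the unit ideal whatever [s] is;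
    [Kres N] is then filtered in a single step. *)
Lemma antilocal_direct_image : antilocal RR B -> direct_image RR B.
Proof.
move=> B_anti R s N RR_R BN.
pose s2 (j : 'I_2) : R := if j == ord0 then s else 1.
apply/(B_anti R 2 s2 RR_R).
  exists (fun j => if j == ord0 then 0 else 1).
  by rewrite big_ord_recl big_ord1 /s2 /= mul0r mul1r add0r.
exists (Kres N); split.
  exists (zero_obj (K k R)), (dinl (Kres N) (zero_obj (K k R))).
  apply: ses_to_zero (ses_dsum _ _) _ => i z; exact: trm_zero.
have [f fid] := ses_of_zero (Kres N) (isomorphic_refl (zero_obj (K k R))).
apply: filtered_step fid (filtered_zero _ (isomorphic_refl _)) _.
(* [s2 ord0] reduces to [s], so [N] already lives over the required ring. *)
by exists ord0, N; split=> //; exact: isomorphic_refl.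
Qed.

Lemma antilocal_descent : antilocal RR B -> descent RR A.
Proof.
move=> B_anti R d s M RR_R s_unit AM.
have B_dir := antilocal_direct_image B_anti.
have EM : E M.
  by apply: E_desc s_unit _ => // j; apply: A_sub_E => //; exact: RR_loc.
apply/(cotorsion_of RR_R).2; split=> // N /(B_anti R d s RR_R s_unit)[F [NF filt]].
(* Membership in [E] is part of the induction because the Ext lemmas for extensions and retracts ask
   for it. *)
suff [EF extF] : E F /\ Ext1_vanishes (@E R) M F.
  have [i [q qi]] := summand_retract NF.
  exact: (Ext1_retract_r (E_ext RR_R) qi EF extF).
move: F filt {NF}; apply: filtered_ind.
- move=> X Y XY [EX extX]; split; first exact: E_iso XY EX.
  have [f [g [gf fg]]] := XY.
  exact: (Ext1_retract_r (E_ext RR_R) fg EX extX).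
- split; first exact: (E_ext RR_R).1.
  by apply: Ext1_zero_r => i x; exact: trm_zero.
move=> X Y Q f g fg [EX extX] [j [Z [BZ QZ]]].
have RR_j := RR_loc (s j) RR_R.
have EZ := B_sub_E RR_j BZ.
have EQ : E Q by apply: (E_iso RR_R (isomorphic_sym QZ)); exact: E_dir.
split; first exact: (extension_mid (E_ext RR_R) fg EX EQ).
apply: (Ext1_extension_r (E_ext RR_R) fg EX EQ extX).
have [a [b [ba _]]] := QZ.
apply: (Ext1_retract_r (E_ext RR_R) ba); first exact: E_dir.
apply: (Ext1_Kres (Es := @E (loc_ring (s j)))) => // [W EW|].
  exact: E_asc.
exact: Ext1_AB.
Qed.

Section VeryLocal.
Hypothesis A_very_local : very_local RR A.

Let A_asc : ascent RR A := A_very_local.1.1.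
Let A_desc : descent RR A := A_very_local.1.2.
Let A_dir : direct_image RR A := A_very_local.2.
Let B_dir : direct_image RR B := ascent_l_direct_image_r A_asc.

Variables (R : comPzRingType) (d : nat) (s : 'I_d -> R).
Hypotheses (RR_R : RR R) (s_unit : unit_ideal s).

Local Notation filtered := (finitely_filtered (restricted_class B s)).

(* The pullback M' along M -> M[s_j0^-1] of a special precover P of M[s_j0^-1]
   satisfies M'[s_j0^-1] = P, while heredity keeps the localizations at the
   indices outside [r] in A. Thus d pullbacks turn M into an object of A. *)
Lemma filtered_precover (r : seq 'I_d) (M : K k R) :
    E M -> (forall j, j \notin r -> A (Kloc (s j) M)) ->
  exists (F X : K k R) (f : hom F X) (g : hom X M), [/\ ses f g, A X & filtered F].
Proof.
elim: r M => [|j0 r IHr] M EM AM.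
  (* With no index left, [M] lies in [A] by descent and is its own precover, with zero kernel. *)
  have [f fid] := ses_of_zero M (isomorphic_refl (zero_obj (K k R))).
  exists (zero_obj (K k R)), M, f, (idm M); split=> //.
    by apply: A_desc s_unit _ => // j; exact: AM.
  exact: filtered_zero (isomorphic_refl _).
have RR_s j := RR_loc (s j) RR_R.
have [[N [P [f0 [g0 [[_ _ _ f0g0] BN AP]]]]] _] :
    (exists Y Z (f : hom Y Z) (g : hom Z (Kloc (s j0) M)),
      [/\ admissible (@E _) f g, B Y & A Z]) /\
    (exists Y Z (f : hom (Kloc (s j0) M) Y) (g : hom Y Z),
      [/\ admissible (@E _) f g, B Y & A Z]).
  by have [_ compl _] := AB_cotorsion (RR_s j0); apply: compl; exact: E_asc.
have EN := B_sub_E (RR_s j0) BN.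
have [M' [f' [q [p [f'q pf' gp]]]]] :=
  ses_pullback (Kunit (s j0) M) (Kres_ses f0g0).
have EM' : E M' by exact: (extension_mid (E_ext RR_R) f'q (E_dir RR_R EN) EM).
have [|F' [X [f [g [fg AX filtF']]]]] := IHr M' EM'.
  move=> j jr; have [->|jj0] := eqVneq j j0.
    (* The adjunct [b] of [p] maps the localized pullback sequence to that of [P], by the counit of
       [N] on the left and the identity on the right, so it is an isomorphism from M'[s_j0^-1] to
       [P]. *)
    have [b bE] := adjoint_ex p.
    have [e [ei eK]] := Kcounit_ex N.
    apply: (A_iso (RR_s j0) (X := P)) => //.
    apply: isomorphic_sym; exists b.
    apply: (iso_middle (Kloc_ses (s j0) f'q) f0g0 (a := e) (c := idm _)) => //.
    - apply: Kunit_eq; rewrite !Kres_comp -!compA -Kunit_nat compA bE pf'.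
      by rewrite eK compm1.
    - apply: Kunit_eq; rewrite comp1m Kres_comp -compA bE gp.
      by rewrite Kunit_nat.
    exact: iso_id.
  have AMj : A (Kloc (s j) M) by apply: AM; rewrite inE negb_or jj0.
  have sesj := Kloc_ses (s j) (Kres_ses f0g0).
  (* The remaining end is the localization of the restricted [N], the kernel of an epimorphism
     between objects of [A]. *)
  apply: (extension_mid (A_extension_closed (RR_s j)) (Kloc_ses (s j) f'q)) => //.
  have AP' : A (Kloc (s j) (Kres P)) by apply: A_asc => //; exact: A_dir.
  (* Up to isomorphism this is M[s_j^-1] localized at the image of [s j0] and restricted back to
     R[s_j^-1]. *)
  have AMjj : A (Kloc (s j) (Kres (Kloc (s j0) M))).
    apply: (A_iso (RR_s j) (Kloc_Kres_Kloc (s j) (s j0) M)).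
    by apply: A_dir => //; exact: A_asc.
  have [_ _ hered] := AB_cotorsion (RR_s j).
  apply: (hered _ _ _ _ _ _ AP' AMjj); split; last exact: sesj.
  - by apply: E_asc => //; exact: E_dir.
  - exact: A_sub_E.
  - exact: A_sub_E.
(* The kernel of the composite from [X] to [M] is an extension of the restricted [N] by [F']: one
   more filtration step. *)
have [U [h [a [b [hqg ab]]]]] := ses_comp_epi fg f'q.
exists U, X, h, (comp q g); split=> //.
apply: filtered_step ab filtF' _.
by exists j0, N; split=> //; exact: isomorphic_refl.
Qed.

(** The summands are stacked on the filtration of [F] one at a time: the kernel of the map from [P]
    to the tail of the sum is an extension of [Kres (D j)] by [F]. *)
Lemma filtered_big_dsum (D : forall j, K k (loc_ring (s j))) (r : seq 'I_d)
    (F P : K k R) (f : hom F P)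
    (g : hom P (\big[@dsum (K k R)/zero_obj (K k R)]_(j <- r) Kres (D j))) :
  (forall j, B (D j)) -> ses f g -> filtered F -> filtered P.
Proof.
move=> BD; elim: r F f g => [|j r IHr] F f g.
  rewrite big_nil in g * => fg filtF.
  apply: filtered_iso_closed filtF; exists f.
  by apply: ses_to_zero fg _ => i z; exact: trm_zero.
rewrite big_cons in g * => fg filtF.
have [U [h [a [b [hg ab]]]]] := ses_comp_epi fg (ses_dsum _ _).
apply: IHr hg _; apply: filtered_step ab filtF _.
by exists j, (D j); split=> //; exact: isomorphic_refl.
Qed.

Lemma preenvelopes (M : K k R) : E M ->
  exists (D Q : forall j, K k (loc_ring (s j)))
    (u : forall j, hom (Kloc (s j) M) (D j)) (q : forall j, hom (D j) (Q j)),
    forall j, [/\ ses (u j) (q j), B (D j) & A (Q j)].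
Proof.
move=> EM.
have pre j : exists (D Q : K k (loc_ring (s j))) (u : hom (Kloc (s j) M) D)
    (q : hom D Q), [/\ ses u q, B D & A Q].
  have [_ compl _] := AB_cotorsion (RR_loc (s j) RR_R).
  have [_ [D [Q [u [q [[_ _ _ uq] BD AQ]]]]]] := compl _ (E_asc (s j) RR_R EM).
  by exists D, Q, u, q.
have [D DP] := dependent_choice pre; have [Q QP] := dependent_choice DP.
have [u uP] := dependent_choice QP; have [q qP] := dependent_choice uP.
by exists D, Q, u, q.
Qed.

Lemma very_local_antilocal (M : K k R) :
  B M <-> exists F, direct_summand M F /\ filtered F.
Proof.
split=> [BM|[F [MF filtF]]]; last first.
  apply: (B_summand_closed RR_R MF); move: F filtF {MF}; apply: filtered_ind.
  - exact: B_iso.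
  - exact: (B_extension_closed RR_R).1.
  move=> X Y Q f g fg BX [j [N [BN QN]]].
  apply: (extension_mid (B_extension_closed RR_R) fg BX).
  by apply: (B_iso RR_R (isomorphic_sym QN)); exact: B_dir.
have EM := B_sub_E RR_R BM.
have [D [Q [u [q uqP]]]] := preenvelopes EM.
have [j|j|j|C [m [c [mc EC]]]] :=
  cech_embedding E_ext E_very_local RR_loc RR_R s_unit (u := u) (q := q).
- by case: (uqP j).
- by apply: B_sub_E; [exact: RR_loc | case: (uqP j)].
- by apply: A_sub_E; [exact: RR_loc | case: (uqP j)].
(* All indices are listed, so the condition on those outside [r] is void. *)
have [|F [X [f [g [fg AX filtF]]]]] := filtered_precover (r := enum 'I_d) EC.
  by move=> j; rewrite mem_enum.
(* [P] carries two sequences: 0 -> M -> P -> X -> 0, which splits, and the one from [F] through [P]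
   to the sum of the [Kres (D j)], which makes [P] filtered. *)
have [P [p [v pb]]] := pullback_ex c g.
have [f1 [f1v _]] := ses_is_pullback mc pb.
have [f2 [f2p _]] := ses_is_pullback fg (is_pullback_sym pb).
have EX := A_sub_E RR_R AX.
have EP := extension_mid (E_ext RR_R) f1v EM EX.
have [r rf1] := (Ext1_retraction _ _ _).1 (Ext1_AB RR_R AX BM) _ f1 v
  (And4 EM EP EX f1v).
exists P; split; first exact: retraction_summand f1v rf1.
by apply: filtered_big_dsum f2p filtF => j; case: (uqP j).
Qed.

Lemma very_local_strongly_antilocal (M : K k R) :
  A M /\ B M <-> exists D : forall j : 'I_d, K k (loc_ring (s j)),
    (forall j, A (D j) /\ B (D j)) /\
    direct_summand M (\big[@dsum (K k R)/zero_obj (K k R)]_(j < d) Kres (D j)).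
Proof.
split=> [[AM BM]|[D [ABD MD]]]; last first.
  split.
    apply: (A_summand_closed RR_R MD).
    apply: big_dsum_closed => [|j]; first exact: A_extension_closed.
    by apply: A_dir => //; case: (ABD j).
  apply: (B_summand_closed RR_R MD).
  apply: big_dsum_closed => [|j]; first exact: B_extension_closed.
  by apply: B_dir => //; case: (ABD j).
have EM := B_sub_E RR_R BM.
have [D [Q [u [q uqP]]]] := preenvelopes EM.
(* A special preenvelope of an object of [A] is an extension of two objects of [A]. *)
have AD j : A (D j).
  have [uq _ AQ] := uqP j; have RR_j := RR_loc (s j) RR_R.
  exact: (extension_mid (A_extension_closed RR_j) uq (A_asc (s j) RR_R AM) AQ).
exists D; split; first by move=> j; split=> //; case: (uqP j).
have [j|//|j|C [m [c [mc AC]]]] :=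
  cech_embedding A_extension_closed A_very_local RR_loc RR_R s_unit
    (u := u) (q := q).
- by case: (uqP j).
- by case: (uqP j).
have EC := A_sub_E RR_R AC.
have [r rm] := (Ext1_retraction _ _ _).1 (Ext1_AB RR_R AC BM) _ m c
  (And4 EM (extension_mid (E_ext RR_R) mc EM EC) EC mc).
exact: retraction_summand mc rm.
Qed.

End VeryLocal.

End CotorsionSystems.

Theorem theorem4p2 (k : ambient) (RR : comPzRingType -> Prop)
    (E A B : forall R : comPzRingType, K k R -> Prop)
    (RR_loc : forall (R : comPzRingType) (s : R), RR R -> RR (loc_ring s))
    (E_iso : forall R, RR R -> iso_closed (@E R))
    (A_iso : forall R, RR R -> iso_closed (@A R))
    (B_iso : forall R, RR R -> iso_closed (@B R))
    (E_ext : forall R, RR R -> extension_closed (@E R))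
    (E_summand : forall R, RR R -> summand_closed (@E R))
    (E_very_local : very_local RR E)
    (A_sub_E : forall R (M : K k R), RR R -> A R M -> E R M)
    (B_sub_E : forall R (M : K k R), RR R -> B R M -> E R M)
    (AB_cotorsion : forall R, RR R ->
      hereditary_complete_cotorsion_pair (@E R) (@A R) (@B R)) :
  [/\ antilocal RR B -> local_system RR A,
      very_local RR A -> antilocal RR B
    & very_local RR A -> strongly_antilocal RR (fun R M => A R M /\ B R M)].
Proof.
split=> [B_anti|A_vl R d s RR_R s_unit M|A_vl R d s RR_R s_unit M].
- split.
    exact: (direct_image_r_ascent_l RR_loc E_ext E_very_local A_sub_E
      AB_cotorsion (antilocal_direct_image B_anti)).
  exact: (antilocal_descent RR_loc E_iso E_ext E_very_local A_sub_E B_sub_E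
    AB_cotorsion B_anti).
- exact: (very_local_antilocal RR_loc A_iso B_iso E_ext E_summand E_very_local
    A_sub_E B_sub_E AB_cotorsion A_vl RR_R s_unit M).
exact: (very_local_strongly_antilocal RR_loc E_ext E_summand E_very_local
  A_sub_E B_sub_E AB_cotorsion A_vl RR_R s_unit M).
Qed.
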